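(* Let $X$ and $Y$ be locally compact Hausdorff spaces, and let $\langle B_X,\pi_X\rangle$ and $\langle B_Y,\pi_Y\rangle$ be non-square Banach bundles over $X$ and $Y$, respectively. Then $\langle B_X,\pi_X\rangle$ and $\langle B_Y,\pi_Y\rangle$ are isometrically isomorphic as Banach bundles if and only if their continuous section spaces $\Gamma_X$ and $\Gamma_Y$ are isometrically isomorphic as Banach spaces (i.e. there is a surjective linear isometry $\Gamma_X\to\Gamma_Y$).
   Context: Let $\mathbb K=\mathbb R$ or $\mathbb C$ be the underlying scalar field of all Banach spaces. Let $X$ be a locally compact Hausdorff space. Banach bundle: a Banach bundle over $X$ is a pair $\langle B_X,\pi_X\rangle$, where $B_X$ is a topological space and $\pi_X$ is a continuous open surjective map from $B_X$ onto $X$ such that, for all $x\in X$, the fiber $B_x=\pi_X^{-1}(x)$ carries a Banach space structure in the subspace topology, satisfying: (1) scalar multiplication, addition and the norm on $B_X$ are all continuous wherever they are defined; (2) if $x\in X$ and $\{b_i\}$ is any net in $B_X$ such that $\|b_i\|\to 0$ and $\pi_X(b_i)\to x$ in $X$, then $b_i\to 0_x$ (the zero element of $B_x$) in $B_X$. Continuous section space: a continuous section of $\langle B_X,\pi_X\rangle$ is a continuous function $f:X\to B_X$ with $\pi_X(f(x))=x$, i.e. $f(x)\in B_x$, for all $x\in X$. $\Gamma_X$ denotes the Banach space, with norm $\|f\|=\sup_{x\in X}\|f(x)\|$, of all continuous sections vanishing at infinity, i.e. with $\lim_{x\to\infty}\|f(x)\|=0$. $\Gamma_Y$ is defined in the same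 way from $\langle B_Y,\pi_Y\rangle$. Isometric isomorphism of bundles: $\langle B_X,\pi_X\rangle$ is isometrically isomorphic to $\langle B_Y,\pi_Y\rangle$ if there are homeomorphisms $\Phi:B_X\to B_Y$ and $\psi:X\to Y$ such that (a) $\pi_Y\circ\Phi=\psi\circ\pi_X$, i.e. $\Phi(B_x)=B_{\psi(x)}$ for all $x\in X$; (b) $\Phi|_{B_x}$ is a linear map from $B_x$ onto $B_{\psi(x)}$ for all $x\in X$; (c) $\|\Phi(b)\|=\|b\|$ for all $b\in B_X$. Non-square: a Banach space $E$ is said to be non-square if $E$ does not contain a copy of the two-dimensional space $\mathbb K\oplus_\infty\mathbb K$ equipped with the norm $\|(a,b)\|=\max\{|a|,|b|\}$; in other words, if $x$ and $y$ are unit vectors in $E$, at least one of $\|x+y\|$ and $\|x-y\|$ is less than $2$. A Banach bundle is non-square if every one of its fiber Banach spaces is non-square.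
   Formalization: Every fiber of both bundles is assumed to be a nonzero Banach space; without this the claim is false: fibers K and 0 over a discrete two-point space and fiber K over one point have the same section space K, but the base spaces are not homeomorphic. *)

(* Defs.v *)
From HB Require Import structures.
From mathcomp Require Import all_boot all_order all_algebra.
From mathcomp Require Import all_classical all_reals all_analysis.
From mathcomp Require Import finmap.
From mathcomp Require Import complex.

Set Implicit Arguments.
Unset Strict Implicit.
Unset Printing Implicit Defensive.

Import Order.TTheory GRing.Theory Num.Theory.
Import numFieldNormedType.Exports.

Local Open Scope classical_set_scope.
Local Open Scope ring_scope.

Variant scalars := RealScalars | ComplexScalars.

Definition scalar_field (R : realType) (s : scalars) : numFieldType :=
  match s with RealScalars => R | ComplexScalars => R[i] end.

(* The Banach space structure on the fiber bproj^-1(x) is given by a Banach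
   space [fiber x] and an injection [incl x] of it into the total space, with
   image bproj^-1(x), for which the norm topology is the subspace topology.

   Norms of MathComp-Analysis are scalar-valued: over R[i] the norm of a vector
   is a nonnegative real element of R[i].

   The operations are defined on K * B, on the fibered product
   {(b, c) | bproj b = bproj c} and on B.  These spaces are parameterized by
   K * {x & fiber x}, {x & fiber x * fiber x} and {x & fiber x}, and have the
   topology induced by K * B, B * B and B: this is the initial topology of the
   map that applies [incl].

   In [small_norm_cvg], the pair (F, b) of a filter on an index type and a
   function plays the role of a net. *)
Record banachBundle (K : numFieldType) (X : topologicalType) := BanachBundle {
  bspace : topologicalType ;
  bproj : bspace -> X ;
  fiber : X -> completeNormedModType K ;
  incl : forall x, fiber x -> bspace ;
  bproj_continuous : continuous bproj ;
  bproj_open : forall U : set bspace, open U -> open (bproj @` U) ;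
  bproj_surj : range bproj = [set: X] ;
  incl_inj : forall x, injective (@incl x) ;
  incl_range : forall x, range (@incl x) = bproj @^-1` [set x] ;
  incl_open : forall x (U : set (fiber x)),
    open U <-> exists2 V : set bspace, open V & @incl x @^-1` V = U ;
  bundle_scale_continuous :
    continuous (fun p : initial_topology
                  (fun q : K * {x & fiber x} => (q.1, incl (tagged q.2))) =>
                incl (p.1 *: tagged p.2)) ;
  bundle_add_continuous :
    continuous (fun p : initial_topology
                  (fun q : {x & (fiber x * fiber x)%type} =>
                     (incl (tagged q).1, incl (tagged q).2)) =>
                incl ((tagged p).1 + (tagged p).2)) ;
  bundle_norm_continuous :
    continuous (fun p : initial_topology
                  (fun q : {x & fiber x} => incl (tagged q)) =>
                `|tagged p|) ;
  small_norm_cvg : forall (x : X) (I : Type) (F : set_system I)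
      (b : I -> {y & fiber y}), ProperFilter F ->
    `|tagged (b i)| @[i --> F] --> (0 : K) ->
    tag (b i) @[i --> F] --> x ->
    incl (tagged (b i)) @[i --> F] --> incl (0 : fiber x)
}.

Definition vanishes_at_infinity (K : numFieldType) (X : topologicalType)
    (B : banachBundle K X) (f : forall x, fiber B x) :=
  forall e : K, 0 < e ->
    exists2 A : set X, compact A & forall x, ~ A x -> `|f x| < e.

Record section_space (K : numFieldType) (X : topologicalType)
    (B : banachBundle K X) := Section {
  section_fun :> forall x, fiber B x ;
  section_continuous : continuous (fun x => incl (section_fun x)) ;
  section_vanishes : vanishes_at_infinity section_fun
}.

Lemma continuous_to_initial (X T : topologicalType) (S : choiceType)
    (g : S -> T) (h : X -> S) : continuous (g \o h) ->
  continuous (h : X -> initial_topology g).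
Proof.
move=> /continuousP gh; apply/continuousP => _ [V oV <-].
by have := gh _ oV; rewrite comp_preimage.
Qed.

Section section_lmodule.
Context (K : numFieldType) (X : topologicalType) (B : banachBundle K X).
Implicit Types f g : section_space B.

Lemma section_ext f g : (forall x, f x = g x) -> f = g.
Proof.
case: f g => [f cf vf] [g cg vg] /= fg.
have E : f = g by apply: functional_extensionality_dep.
by subst g; congr Section; exact: Prop_irrelevance.
Qed.

HB.instance Definition _ := gen_eqMixin (section_space B).
HB.instance Definition _ := gen_choiceMixin (section_space B).

Lemma zero_section_continuous : continuous (fun x => incl (0 : fiber B x)).
Proof.
move=> x.
apply: (@small_norm_cvg _ _ B x X (nbhs x)
          (fun y => existT (fiber B) y 0)) => /=; last exact: cvg_id.
under eq_fun do rewrite normr0.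
exact: cvg_cst.
Qed.

Lemma zero_section_vanishes :
  vanishes_at_infinity (fun x => 0 : fiber B x).
Proof. by move=> e e0; exists set0; [exact: compact0|move=> x _; rewrite normr0]. Qed.

Definition section_zero := Section zero_section_continuous zero_section_vanishes.

Lemma section_add_continuous f g : continuous (fun x => incl (f x + g x)).
Proof.
move=> x.
pose s y : {y & (fiber B y * fiber B y)%type} := existT _ y (f y, g y).
pose I := initial_topology
   (fun q : {y & (fiber B y * fiber B y)%type} =>
                     (incl (tagged q).1, incl (tagged q).2)).
apply: (@continuous_comp X I (bspace B) s
   (fun p => incl ((tagged p).1 + (tagged p).2))).
  apply: continuous_to_initial => y.
  by apply: cvg_pair => /=; exact: section_continuous.
exact: bundle_add_continuous.
Qed.

Lemma section_add_vanishes f g : vanishes_at_infinity (fun x => f x + g x).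
Proof.
move=> e e0.
have e20 : 0 < e / 2 by rewrite divr_gt0.
have [A cA fA] := section_vanishes f e20.
have [A' cA' gA'] := section_vanishes g e20.
exists (A `|` A'); first exact: compactU.
move=> x AA'; rewrite (le_lt_trans (ler_normD _ _))// (splitr e) ltrD//.
- by apply: fA => Ax; apply: AA'; left.
- by apply: gA' => Ax; apply: AA'; right.
Qed.

Definition section_add f g :=
  Section (@section_add_continuous f g) (@section_add_vanishes f g).

Lemma section_scale_continuous (a : K) f : continuous (fun x => incl (a *: f x)).
Proof.
move=> x.
pose s y : K * {y & fiber B y} := (a, existT _ y (f y)).
pose I := initial_topology
   (fun q : K * {y & fiber B y} => (q.1, incl (tagged q.2))).
apply: (@continuous_comp X I (bspace B) s
   (fun p => incl (p.1 *: tagged p.2))).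
  apply: continuous_to_initial => y.
  apply: (@cvg_pair X K (bspace B) (nbhs y) (nbhs a) (nbhs (incl (f y)))
    _ _ _ (fun=> a) (fun z => incl (f z))); first exact: cvg_cst.
  exact: section_continuous.
exact: bundle_scale_continuous.
Qed.

Lemma section_scale_vanishes (a : K) f :
  vanishes_at_infinity (fun x => a *: f x).
Proof.
move=> e e0.
have a0 : 0 < `|a| + 1 by rewrite ltr_wpDl.
have [A cA fA] := section_vanishes f (divr_gt0 e0 a0).
exists A => // x /fA; rewrite ltr_pdivlMr// => h.
rewrite normrZ (le_lt_trans _ h)// mulrC ler_wpM2l// lerDl//.
Qed.

Definition section_scale (a : K) f :=
  Section (@section_scale_continuous a f) (@section_scale_vanishes a f).

Definition section_opp f := section_scale (-1) f.

Lemma section_addA : associative section_add.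
Proof. by move=> f g h; apply: section_ext => x /=; rewrite addrA. Qed.

Lemma section_addC : commutative section_add.
Proof. by move=> f g; apply: section_ext => x /=; rewrite addrC. Qed.

Lemma section_add0 : left_id section_zero section_add.
Proof. by move=> f; apply: section_ext => x /=; rewrite add0r. Qed.

Lemma section_addN : left_inverse section_zero section_opp section_add.
Proof. by move=> f; apply: section_ext => x /=; rewrite scaleN1r addNr. Qed.

HB.instance Definition _ := GRing.isZmodule.Build (section_space B)
  section_addA section_addC section_add0 section_addN.

Lemma section_scaleA a b f :
  section_scale a (section_scale b f) = section_scale (a * b) f.
Proof. by apply: section_ext => x /=; rewrite scalerA. Qed.

Lemma section_scale1 : left_id 1 section_scale.
Proof. by move=> f; apply: section_ext => x /=; rewrite scale1r. Qed.

Lemma section_scaleDr : right_distributive section_scale +%R.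
Proof. by move=> a f g; apply: section_ext => x /=; rewrite scalerDr. Qed.

Lemma section_scaleDl f : {morph section_scale^~ f : a b / a + b}.
Proof. by move=> a b; apply: section_ext => x /=; rewrite scalerDl. Qed.

HB.instance Definition _ := GRing.Zmodule_isLmodule.Build K (section_space B)
  section_scaleA section_scale1 section_scaleDr section_scaleDl.

(* The supremum is 0 when X is empty. *)
Definition section_norm f : K := supremum 0 (range (fun x => `|f x|)).

Lemma section_bounded f : exists M, forall x, `|f x| <= M.
Proof.
have [A cA fA] := section_vanishes f (@ltr01 K).
have nc : continuous (fun x => `|f x|).
  move=> x.
  apply: (@continuous_comp X (initial_topology
     (fun q : {y & fiber B y} => incl (tagged q))) K
     (fun y => existT _ y (f y)) (fun p => `|tagged p|)).
    by apply: continuous_to_initial; exact: section_continuous.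
  exact: bundle_norm_continuous.
have : compact ((fun x => `|f x|) @` A).
  by apply: continuous_compact => //; exact: continuous_subspaceT.
rewrite compact_cover => /(_ K setT (fun c => ball c (1 : K))).
case=> [c _|c _|D _ AD]; first exact: ball_open.
  by exists c => //; exact: ballxx.
exists (\sum_(c <- enum_fset D) (`|c| + 1) + 1) => x.
have [Ax|nAx] := pselect (A x); last first.
  rewrite (le_trans (ltW (fA _ nAx)))// lerDr.
  by apply: sumr_ge0 => c _; rewrite addr_ge0.
have [c cD] := AD _ (ex_intro2 _ _ x Ax erefl).
rewrite -ball_normE /ball_/= distrC => fxc.
have {fxc} fxc : `|f x| <= `|c| + 1.
  rewrite -(normr_id (f x)) -[X in `|X|](subrK c) addrC.
  by rewrite (le_trans (ler_normD _ _))// lerD2l ltW.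
rewrite (le_trans fxc)// (big_rem c)//= -addrA lerDl addr_ge0//.
by apply: sumr_ge0 => ? _; rewrite addr_ge0.
Qed.

End section_lmodule.

Lemma scalar_supremums (R : realType) (s : scalars)
    (E : set (scalar_field R s)) (M : scalar_field R s) :
  E !=set0 -> (forall a, E a -> 0 <= a <= M) -> supremums E !=set0.
Proof.
case: s E M => /= E M [a0 Ea0] EM.
- have hE : has_sup E.
    by split; [exists a0|exists M => a /EM /andP[]].
  exists (sup E); split; first by move=> a Ea; exact: ub_le_sup hE.2 _ Ea.
  by move=> b Eb; apply: ge_sup => //; exists a0.
- have ER (a : R[i]) : E a -> a = (complex.Re a)%:C%C.
    move=> /EM /andP[]; case: a => a b.
    by rewrite lecE /= => /andP[/eqP-> _].
  have MR : M = (complex.Re M)%:C%C.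
    have /andP[h1 h2] := EM _ Ea0; have := le_trans h1 h2; case: M {EM h1 h2} => a b.
    by rewrite lecE /= => /andP[/eqP-> _].
  pose E' := (@complex.Re R) @` E.
  have hE : has_sup E'.
    split; first by exists (complex.Re a0), a0.
    exists (complex.Re M) => _ [a Ea <-].
    have /andP[_] := EM _ Ea.
    by rewrite lecE => /andP[].
  exists ((sup E')%:C%C); split.
    move=> a Ea; rewrite (ER _ Ea) lecR.
    by apply: ub_le_sup hE.2 _ _; exists a.
  move=> b Eb.
  have bR : b = (complex.Re b)%:C%C.
    have /andP[h1 _] := EM _ Ea0.
    have := le_trans h1 (Eb _ Ea0); case: b {Eb} => a b.
    by rewrite lecE /= => /andP[/eqP-> _].
  rewrite bR lecR; apply: ge_sup hE.1 _ => _ [a /Eb + <-].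
  by rewrite lecE => /andP[].
Qed.

Section section_normed.
Context (R : realType) (s : scalars) (X : topologicalType).
Local Notation K := (scalar_field R s).
Context (B : banachBundle K X).
Implicit Types f g : section_space B.

Lemma section_norm_supremums f :
  [set: X] !=set0 -> supremums (range (fun x => `|f x|)) (section_norm f).
Proof.
move=> [x0 _]; rewrite /section_norm /supremum.
have [M fM] := section_bounded f.
have E0 : range (fun x => `|f x|) !=set0 by exists `|f x0|, x0.
rewrite ifF; last by apply/negP => /eqP; exact/eqP/set0P.
have [|m sm] := @scalar_supremums R s (range (fun x => `|f x|)) M E0.
  by move=> _ [x _ <-]; rewrite normr_ge0 fM.
by case: xgetP => // /(_ m).
Qed.

Lemma section_norm_ub f x : `|f x| <= section_norm f.
Proof.
have [|ub _] := @section_norm_supremums f; first by exists x.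
by apply: ub; exists x.
Qed.

Lemma section_norm_le f (M : K) :
  0 <= M -> (forall x, `|f x| <= M) -> section_norm f <= M.
Proof.
move=> M0 fM; have [X0|X0] := pselect ([set: X] !=set0).
  have [_ lb] := section_norm_supremums f X0.
  by apply: lb => _ [x _ <-].
rewrite /section_norm [X in supremum _ X](_ : _ = set0) ?supremum0//.
by apply/seteqP; split => // y [x _ _]; apply: X0; exists x.
Qed.

Lemma section_norm_ge0 f : 0 <= section_norm f.
Proof.
have [X0|X0] := pselect ([set: X] !=set0).
  by have [x _] := X0; exact: le_trans (section_norm_ub f x).
rewrite /section_norm [X in supremum _ X](_ : _ = set0) ?supremum0//.
by apply/seteqP; split => // y [x _ _]; apply: X0; exists x.
Qed.

Lemma section_norm_triangle f g :
  section_norm (f + g) <= section_norm f + section_norm g.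
Proof.
apply: section_norm_le => [|x]; first by rewrite addr_ge0// section_norm_ge0.
by rewrite (le_trans (ler_normD _ _))// lerD// section_norm_ub.
Qed.

Lemma section_norm_eq0 f : section_norm f = 0 -> f = 0.
Proof.
move=> f0; apply: section_ext => x; apply/eqP; rewrite -normr_le0 -f0.
exact: section_norm_ub.
Qed.

Lemma section_norm_scale (a : K) f :
  section_norm (a *: f) = `|a| * section_norm f.
Proof.
have le (b : K) (h : section_space B) : section_norm (b *: h) <= `|b| * section_norm h.
  apply: section_norm_le => [|x]; first by rewrite mulr_ge0// section_norm_ge0.
  by rewrite normrZ ler_wpM2l// section_norm_ub.
apply/eqP; rewrite eq_le le /=.
have [->|a0] := eqVneq a 0; first by rewrite normr0 mul0r section_norm_ge0.
have := le a^-1 (a *: f); rewrite scalerA mulVf// scale1r normfV.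
by rewrite mulrC ler_pdivlMr ?normr_gt0// mulrC.
Qed.

HB.instance Definition _ := Lmodule_isNormed.Build K (section_space B)
  section_norm_triangle section_norm_scale section_norm_eq0.

End section_normed.

Definition homeomorphism (T U : topologicalType) (f : T -> U) :=
  continuous f /\
  exists2 g : U -> T, continuous g & cancel f g /\ cancel g f.

Definition bundle_isomorphic (K : numFieldType) (X Y : topologicalType)
    (BX : banachBundle K X) (BY : banachBundle K Y) :=
  exists (Phi : bspace BX -> bspace BY) (psi : X -> Y),
    [/\ homeomorphism Phi, homeomorphism psi,
        (forall b, bproj (Phi b) = psi (bproj b)) &
        forall x, exists L : {linear fiber BX x -> fiber BY (psi x)},
          [/\ forall u, Phi (incl u) = incl (L u),
              range L = setT &
              forall u, `|L u| = `|u|]].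

Definition isometrically_isomorphic (K : numFieldType)
    (V W : normedModType K) :=
  exists T : {linear V -> W}, range T = setT /\ forall v, `|T v| = `|v|.

(* The product norm on K^o * K^o is the maximum norm.  "Copy" means isometric
   copy.  For real scalars this says that unit vectors u and v always have
   `|u + v| < 2 or `|u - v| < 2.  For complex scalars it is weaker than that:
   the complex l^1-sum of two lines violates the latter at its unit basis
   vectors, but is not isometric to K^o * K^o. *)
Definition nonsquare (K : numFieldType) (E : normedModType K) :=
  ~ exists L : {linear (K^o * K^o)%type -> E}, forall p, `|L p| = `|p|.

Definition nonsquare_bundle (K : numFieldType) (X : topologicalType)
    (B : banachBundle K X) := forall x, nonsquare (fiber B x).

(* A zero fiber is nonsquare but invisible to sections: the bundle with fibers
   K and 0 over a discrete two-point space has the same section space as the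
   bundle with fiber K over a point. *)
Definition nonzero_fibers (K : numFieldType) (X : topologicalType)
    (B : banachBundle K X) := forall x, exists u : fiber B x, u != 0.

(* Main.v *)
From Pilot Require Import Defs.
From HB Require Import structures.
From mathcomp Require Import all_boot all_order all_algebra.
From mathcomp Require Import all_classical all_reals all_analysis.
From mathcomp Require Import finmap complex ring lra.
(* [incl] is also the name of a map of classical sets. *)
Import Pilot.Defs.

Set Implicit Arguments.
Unset Strict Implicit.
Unset Printing Implicit Defensive.

Import Order.TTheory GRing.Theory Num.Theory.
Import numFieldNormedType.Exports.

Local Open Scope classical_set_scope.
Local Open Scope ring_scope.

(** A bundle isomorphism acts on sections by [f |-> Phi \o f \o psi^-1], which is
    a surjective linear isometry ([isometry_of_bundle_isomorphic]).

    Conversely, let [T] be a surjective linear isometry of section spaces, with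
    inverse [T'].  For a continuous [h : Y -> [0, 1]] consider the operator
    [S h f = T' (h * T f)].  Whenever [k] and [k - f] lie in a ball centred at
    [0], so does [k - S h f], because pointwise [T k - h * T f] is a convex
    combination of [T k] and [T (k - f)].  Testing this with [k] a large negative
    multiple of [S h f] concentrated near a point [x] shows that [S h f x]
    depends on [f x] only ([transported_mul_local]).  So the multiplications by
    functions on [Y] act fiber by fiber on the bundle over [X], although no
    relation between [X] and [Y] is known yet.  If [h1 * h2 = 0], nonzero values
    of [S h1] and [S h2] at [x] would span a copy of the plane with the maximum
    norm, as sections with disjoint supports do over [Y]; in a nonsquare fiber,
    one of the two operators is therefore zero at [x].  Hence there is at most
    one point [psi x] of [Y] such that functions [h] with arbitrarily small
    support around it have [S h] nonzero at [x] ([in_support_unique]).  A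
    partition of unity on [Y] shows
    that [psi x] exists and that [`|f x| <= `|T f (psi x)|]
    ([isometry_domination]).  The same inequality for [T'] gives a point map in
    the other direction.  The composites dominate norms at one point by norms at
    another, so they are identities, and [`|T f (psi x)| = `|f x|].  Therefore
    [f x |-> T f (psi x)] is well defined on fibers, linear, isometric and onto,
    and it is continuous on the total space.

    All of this needs a continuous section through every point of the total
    space, which is the theorem of Douady and dal Soglio-Herault
    ([enough_sections]).  It is proved by successive approximation: an arbitrary
    family of vectors that is continuous up to an error [e] is replaced, with
    change at most [e], by one that is continuous up to [e / 2], gluing local
    choices with a partition of unity; completeness of the fibers gives the
    limit. *)

(** * Real scalars and partitions of unity *)

(** Functions on the base spaces are real-valued, and norms and scalars lie in
    the scalar field: this is the embedding of the first into the second. *)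
Definition scal (R : realType) (s : scalars) : R -> scalar_field R s :=
  match s with RealScalars => fun r => r | ComplexScalars => fun r => r%:C%C end.
Arguments scal {R s}.

Section scalars_of_reals.
Context {R : realType} {s : scalars}.
Local Notation K := (scalar_field R s).
Implicit Types (r t : R) (a b e : K).

Lemma scal0 : scal 0 = 0 :> K. Proof. by rewrite /scal; case: s. Qed.
Lemma scal1 : scal 1 = 1 :> K. Proof. by rewrite /scal; case: s. Qed.
Lemma scalD r t : scal (r + t) = scal r + scal t :> K.
Proof. by rewrite /scal; case: s => //=; rewrite rmorphD. Qed.
Lemma scal_sum (I : Type) (l : seq I) (F : I -> R) :
  scal (\sum_(i <- l) F i) = \sum_(i <- l) scal (F i) :> K.
Proof. by apply: (big_morph _ scalD scal0). Qed.
Lemma scalB r t : scal (r - t) = scal r - scal t :> K.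
Proof. by apply/eqP; rewrite eq_sym subr_eq -scalD subrK. Qed.
Lemma scal_le r t : (scal r <= scal t :> K) = (r <= t).
Proof. by rewrite /scal; case: s => //=; rewrite lecR. Qed.

Lemma scal_surj a : 0 <= a -> exists r, a = scal r.
Proof.
rewrite /scal; case: s a => /= a; first by exists a.
by case: a => x y; rewrite lecE /= => /andP[/eqP-> _]; exists x.
Qed.

Lemma scal_lt r t : (scal r < scal t :> K) = (r < t).
Proof. by rewrite /scal; case: s => //=; rewrite ltcR. Qed.

Lemma scal_norm r : `|scal r : K| = scal `|r|.
Proof.
have [r0|r0] := ger0P r; first by rewrite ger0_norm// -scal0 scal_le.
rewrite ltr0_norm; last by rewrite -scal0 scal_lt.
by rewrite -[in RHS]sub0r scalB scal0 sub0r.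
Qed.

Lemma scal_continuous : continuous (scal : R -> K).
Proof.
move=> r; apply/cvgrPdist_lt => e e0.
have [d ed] := scal_surj (ltW e0).
have d0 : 0 < d by rewrite -scal_lt -ed scal0.
near=> t; rewrite -scalB scal_norm ed scal_lt.
by near: t; apply: (@cvgr_dist_lt _ R^o).
Unshelve. all: by end_near. Qed.

End scalars_of_reals.

Lemma continuous_sum_seq (K : numFieldType) (W : normedModType K)
    (T : topologicalType) (I : eqType) (D : seq I) (g : I -> T -> W) :
  (forall i, i \in D -> continuous (g i)) ->
  continuous (fun z => \sum_(i <- D) g i z).
Proof.
elim: D => [|i D IH] cg z.
  rewrite (_ : (fun z => _) = fun=> 0); first exact: cvg_cst.
  by apply/funext => w; rewrite big_nil.
rewrite (_ : (fun z => _) = (g i) \+ fun z => \sum_(i <- D) g i z); last first.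
  by apply/funext => w; rewrite big_cons.
apply: cvgD; first by apply: cg; rewrite inE eqxx.
by apply: IH => j jD; apply: cg; rewrite inE jD orbT.
Qed.

Lemma hausdorff_nbhs_setC1 (X : topologicalType) (x y : X) :
  hausdorff_space X -> y <> x -> nbhs y (~` [set x]).
Proof.
move=> hX yx; apply: open_nbhs_nbhs; split=> //; apply: closed_openC.
exact/accessible_closed_set1/hausdorff_accessible.
Qed.

Section bumps.
Context {R : realType} {X : topologicalType}.
Hypotheses (hX : hausdorff_space X) (lX : locally_compact [set: X]).

Lemma real_bump (x : X) (V : set X) : nbhs x V ->
  exists f : X -> R, [/\ continuous f, forall z, 0 <= f z <= 1, f x = 1 &
    forall z, ~ V z -> f z = 0].
Proof.
move=> Vx.
have /(@uniform_separatorP _ R) [f [cf f01 fx fV]] :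
    uniform_separator [set x] (~` V°).
  apply: (@locally_compact_completely_regular X R lX hX) => /=.
    exact/open_closedC/open_interior.
  by apply.
exists (fun z => 1 - f z); split.
- by move=> z; apply: (@cvgB _ R^o); [exact: cvg_cst|exact: cf].
- move=> z; have : range f (f z) by exists z.
  by move=> /f01; rewrite /= in_itv/= => /andP[? ?]; lra.
- have -> : f x = 0 by apply: fx; exists x.
  by rewrite subr0.
- move=> z nVz; have -> : f z = 1; last by rewrite subrr.
  by apply: fV; exists z => // /interior_subset.
Qed.

(** The equivalence [compact_cover] is about pointed spaces; a nonempty compact
    set provides the point. *)
Lemma compact_finite_cover (C : set X) (V : X -> set X) : compact C ->
  (forall y, C y -> open (V y) /\ V y y) ->
  exists2 D : seq X, (forall y, y \in D -> C y) &
    forall z, C z -> exists2 y, y \in D & V y z.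
Proof.
move=> cC oV; have [->|/set0P[x0 _]] := eqVneq C set0; first by exists [::].
pose X' : ptopologicalType := HB.pack_for ptopologicalType X (isPointed.Build X x0).
move: (cC); rewrite (_ : compact C = cover_compact (T := X') C); last first.
  by rewrite -(compact_cover X').
case/(_ _ C V) => [y /oV[]//|z Cz|D DC CD].
  by exists z => //; case: (oV _ Cz).
exists (enum_fset D) => [y /DC/set_mem//|z /CD[y yD Vyz]].
by exists y.
Qed.

(** The alternatives of the last clause overlap, so that the functions [l y]
    have closed support in the interior of [V y]; each point then has a
    neighborhood on which [l y] is either zero or multiplies only values taken
    in [V y]. *)
Lemma real_partition_of_unity (C : set X) (V : X -> set X) : compact C ->
  (forall y, C y -> nbhs y (V y)) ->
  exists (D : seq X) (l : X -> X -> R),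
    [/\ forall y, y \in D -> C y,
        forall y, y \in D -> continuous (l y),
        forall y z, y \in D -> 0 <= l y z,
        (forall z, \sum_(y <- D) l y z <= 1) /\
        (forall z, C z -> \sum_(y <- D) l y z = 1) &
        forall y (z : X), y \in D -> nbhs z (V y) \/ \forall w \near z, l y w = 0].
Proof.
move=> cC nV.
have /choice[b bP] : forall y, exists f : X -> R, C y -> [/\ continuous f,
    forall z, 0 <= f z <= 1, f y = 1 & forall z, ~ (V y)° z -> f z = 0].
  move=> y; have [Cy|nCy] := pselect (C y); last by exists (fun=> 0).
  have /real_bump[f fP] : nbhs y (V y)°.
    by apply: open_nbhs_nbhs; split; [exact: open_interior|exact: nV].
  by exists f.
(* Cutting [b] at height 1/2 makes [g] zero near each point where [b] is zero. *)
pose g y z : R := Num.max 0 (2 * b y z - 1).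
have cg y : C y -> continuous (g y).
  move=> /bP[cb _ _ _] z; apply: (@continuous_max R X (fun=> 0) (fun z => 2 * b y z - 1)).
    exact: cvg_cst.
  apply: (@cvgB _ R^o); last exact: cvg_cst.
  by apply: (@cvgM R); [exact: cvg_cst|exact: cb].
have g0 y z : 0 <= g y z by rewrite /g le_max lexx.
have [|D DC CD] := @compact_finite_cover C (fun y => b y @^-1` [set r : R | 3/4 < r]) cC.
  move=> y /bP[cb _ by1 _]; split; last by rewrite /= by1; lra.
  by move/continuousP: cb; apply; exact: (@open_gt R).
pose S z := \sum_(y <- D) g y z.
have cS : continuous S.
  by apply: (@continuous_sum_seq _ R^o) => y /DC; exact: cg.
(* [S] exceeds 1/2 on [C], so there [M = S]; elsewhere [M] keeps the quotient
   continuous and the sum at most 1. *)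
pose M z : R := Num.max (1/2) (S z).
have M0 z : 0 < M z by rewrite /M lt_max; apply/orP; left; lra.
have cM : continuous M.
  by move=> z; apply: (@continuous_max R X (fun=> 1/2) S); [exact: cvg_cst|exact: cS].
exists D, (fun y z => g y z / M z); split => //.
- move=> y /DC Cy z; apply: (@cvgM R); first exact: cg.
  by apply: (@cvgV R) => //; [rewrite gt_eqF|exact: cM].
- by move=> y z yD; rewrite divr_ge0// ltW.
- split=> z; rewrite -mulr_suml.
    by rewrite ler_pdivrMr// mul1r /M le_max lexx orbT.
  move=> /CD[y yD /= bz].
  have Sz : 1 / 2 < S z.
    rewrite /S (big_rem y yD)/= (@lt_le_trans _ _ (g y z))//.
      by rewrite /g lt_max; apply/orP; right; lra.
    by rewrite lerDl sumr_ge0.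
  have MS : M z = S z by apply/max_r/ltW.
  by rewrite -/(S z) -MS divff// gt_eqF.
- move=> y z /DC /[dup] Cy /bP[cb _ _ bV].
  have [Vz|/bV bz] := pselect ((V y)° z); first by left.
  right; have : \forall w \near z, b y w < 1/2.
    have : b y w @[w --> z] --> b y z by exact: cb.
    by rewrite bz => /(@cvgr_lt R); apply; lra.
  apply: filterS => w bw; rewrite /g (_ : Num.max _ _ = 0) ?mul0r//.
  by apply/max_l; lra.
Qed.

Lemma compact_nbhs (x : X) : exists C : set X, [/\ compact C, closed C & nbhs x C].
Proof.
have := lX (I : [set: X] x); case=> C xC [cC clC]. 
by exists C; split => //; move: xC; rewrite /within/=; apply: filterS => y; exact.
Qed.

End bumps.

(** * The bundle axioms in terms of neighborhoods *)

Lemma initial_nbhs (S : choiceType) (T : topologicalType) (g : S -> T) (q : S)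
    (A : set S) :
  @nbhs _ (initial_topology g) (q : initial_topology g) A ->
  exists2 O : set T, nbhs (g q) O & forall p, O (g p) -> A p.
Proof.
rewrite nbhsE => -[W [ [ O oO E] Wq] WA]; subst W.
by exists O; [exists O|move=> p; exact: WA].
Qed.

Section bundle_nbhs.
Context (K : numFieldType) (X : topologicalType) (B : banachBundle K X).
Local Notation inc x := (@incl K X B x).

Lemma bproj_incl x (u : fiber B x) : bproj (incl u) = x.
Proof.
have : range (inc x) (incl u) by exists u.
by rewrite incl_range.
Qed.

Lemma incl_surj x (b : bspace B) : bproj b = x -> exists u : fiber B x, incl u = b.
Proof.
move=> bx; have : (@bproj K X B @^-1` [set x]) b by [].
by rewrite -incl_range => -[u _ <-]; exists u.
Qed.

Lemma add_nbhs x (u v : fiber B x) (O : set (bspace B)) : nbhs (incl (u + v)) O ->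
  exists O1 O2 : set (bspace B), [/\ nbhs (incl u) O1, nbhs (incl v) O2 &
    forall y (a b : fiber B y), O1 (incl a) -> O2 (incl b) -> O (incl (a + b))].
Proof.
move=> uvO.
have := @bundle_add_continuous K X B (existT _ x (u, v)) O uvO.
case/initial_nbhs => Q [ [ O1 O2] /= [uO1 vO2] O12] OO.
exists O1, O2; split=> // y a b O1a O2b.
by apply: (OO (existT _ y (a, b))); apply: O12.
Qed.

Lemma scale_nbhs x (k : K) (u : fiber B x) (O : set (bspace B)) :
  nbhs (incl (k *: u)) O ->
  exists (A : set K) (O1 : set (bspace B)), [/\ nbhs k A, nbhs (incl u) O1 &
    forall y l (a : fiber B y), A l -> O1 (incl a) -> O (incl (l *: a))].
Proof.
move=> uvO.
have := @bundle_scale_continuous K X B (k, existT _ x u) O uvO.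
case/initial_nbhs => Q [ [ O1 O2] /= [uO1 vO2] O12] OO.
exists O1, O2; split=> // y l a O1a O2b.
by apply: (OO (l, existT _ y a)); apply: O12.
Qed.

Lemma norm_nbhs x (u : fiber B x) (e : K) : 0 < e ->
  exists2 O : set (bspace B), nbhs (incl u) O &
    forall y (a : fiber B y), O (incl a) -> `| `|u| - `|a| | < e.
Proof.
move=> e0.
have := @bundle_norm_continuous K X B (existT _ x u) _ (nbhsx_ballx _ _ e0).
case/initial_nbhs => O /= uO OO; exists O => // y a Oa.
exact: (OO (existT _ y a)).
Qed.

Lemma small_nbhs x (O : set (bspace B)) : nbhs (incl (0 : fiber B x)) O ->
  exists2 d : K, 0 < d & \forall y \near x, forall a : fiber B y, `|a| < d -> O (incl a).
Proof.
move=> O0.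
(* The net of all vectors, ordered by smallness of the norm and closeness of the
   base point to [x]. *)
pose F : set_system {y & fiber B y} := filter_from
   [set p : set X * K | nbhs x p.1 /\ 0 < p.2]
   (fun p => [set q : {y & fiber B y} | p.1 (tag q) /\ `|tagged q| < p.2]).
have FF : ProperFilter F.
  apply: filter_from_proper; last first.
    move=> [V d] [/= xV d0]; exists (existT (fiber B) x (0 : fiber B x)) => /=.
    by rewrite normr0; split => //; exact: nbhs_singleton.
  apply: filter_from_filter.
    by exists (setT, 1); split => //=; exact: filterT.
  move=> [V d] [V' d'] [/= xV d0] [/= xV' d'0].
  have dd : (d >=< d')%R by rewrite real_comparable// ger0_real// ltW.
  exists (V `&` V', Num.min d d') => /=.
    by split; [exact: filterI|rewrite comparable_lt_min// d0].
  by move=> q /= [[Vq V'q]]; rewrite comparable_lt_min// => /andP[].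
have /(_ O O0) : incl (tagged q) @[q --> F] --> incl (0 : fiber B x); last first.
  move=> [ [V d] [/= xV d0] h]; exists d => //.
  by apply: filterS xV => y Vy a ad; exact: (h (existT _ y a)).
apply: (@small_norm_cvg K X B x _ F id FF).
- apply/cvgrPdist_lt => e e0; exists (setT, e) => //=.
    by split => //; exact: filterT.
  by move=> q /= [_]; rewrite sub0r normrN normr_id.
- move=> V xV; exists (V, 1) => //=.
  by move=> q /= [].
Qed.

(** This is openness of the projection. *)
Lemma fiberwise_nbhs x (u : fiber B x) (O : set (bspace B)) : nbhs (incl u) O ->
  \forall y \near x, exists a : fiber B y, O (incl a).
Proof.
rewrite nbhsE => -[W [oW Wu] WO].
rewrite /prop_near1 nbhsE. exists (@bproj K X B @` W).
  by split; [exact: bproj_open|exists (incl u) => //; exact: bproj_incl].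
move=> y [b Wb by_]; have [a ab] := incl_surj by_.
by exists a; rewrite ab; exact: WO.
Qed.

Lemma proj_nbhs x (u : fiber B x) (V : set X) : nbhs x V ->
  nbhs (incl u) [set b : bspace B | V (bproj b)].
Proof. by move=> xV; apply: (@bproj_continuous _ _ B (incl u)); rewrite bproj_incl. Qed.

Lemma incl_continuous x : continuous (inc x).
Proof.
apply/continuousP => W oW; apply/(@incl_open _ _ B x); by exists W.
Qed.

(** Perturbing a vector by a small vector of its own fiber changes little,
    uniformly over nearby fibers.  Continuity in the total space is always
    deduced from norm estimates in the fibers through this lemma. *)
Lemma tube_nbhs x (u : fiber B x) (O : set (bspace B)) : nbhs (incl u) O ->
  exists O1 (d : K), [/\ nbhs (incl u) O1, 0 < d &
    forall y (a b : fiber B y), O1 (incl a) -> `|b - a| < d -> O (incl b)].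
Proof.
move=> uO; have : nbhs (incl (u + 0)) O by rewrite addr0.
move=> /add_nbhs[ O1 [ O2 [uO1 O20 O12]]].
have [d d0 dV] := small_nbhs O20.
exists (O1 `&` [set b | forall a : fiber B (bproj b), `|a| < d -> O2 (incl a)]), d.
split => //; first by apply: filterI => //; exact: (proj_nbhs u dV).
move=> y a b [ O1a Va] bad; rewrite -(subrK a b) addrC.
by apply: O12 => //; move: Va; rewrite /= bproj_incl; apply.
Qed.

(** The neighborhood meets other fibers, where closeness to [u] itself cannot be
    expressed by a norm. *)
Lemma thin_nbhs x (u : fiber B x) (e : K) : 0 < e ->
  exists2 O : set (bspace B), nbhs (incl u) O &
    forall y (a b : fiber B y), O (incl a) -> O (incl b) -> `|a - b| < e.
Proof.
move=> e0; have [W] := @norm_nbhs x (u - u) e e0.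
move=> /add_nbhs[ O1 [ O2 [uO1 uO2 O12]]] Oe.
move: uO2; rewrite -scaleN1r => /scale_nbhs[A [ O3 [kA uO3 AO]]].
exists (O1 `&` O3); first exact: filterI.
move=> y a b [ O1a _] [_ bO3].
have := Oe y (a - b); rewrite subrr normr0 sub0r normrN normr_id; apply.
apply: O12 => //; rewrite -scaleN1r; apply: AO => //; exact: nbhs_singleton.
Qed.

End bundle_nbhs.

(** * Sections through a given vector over a compact set *)

Lemma dependent_function_choice (T : Type) (P : T -> Type) (Q : forall t, P t -> Prop) :
  (forall t, exists p, Q t p) -> exists f : forall t, P t, forall t, Q t (f t).
Proof.
by move=> h; exists (fun t => sval (cid (h t))) => t; exact: (svalP (cid (h t))).
Qed.

Section tracking.
Context (R : realType) (s : scalars) (X : topologicalType).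
Local Notation K := (scalar_field R s).
Context (B : banachBundle K X).

(** Up to an error [e] in the norm of the fibers, the family [f], restricted to
    [C], is continuous at [y] with value [c].  The value [f y] itself need not be
    [c]: it is only within [e] of it. *)
Definition tracked (C : set X) (e : K) (f : forall z, fiber B z) (y : X)
    (c : fiber B y) :=
  forall U : set (bspace B), nbhs (incl c) U -> \forall z \near y, C z ->
    exists2 a : fiber B z, U (incl a) & `|a - f z| <= e.

Lemma tracked_dist C e f y (c : fiber B y) : C y -> tracked C e f c ->
  `|c - f y| <= e.
Proof.
move=> Cy fc; apply/ler_addgt0Pr => d d0.
have [U cU Ud] := thin_nbhs c d0.
have [a Ua ae] := nbhs_singleton (fc U cU) Cy.
rewrite -(subrK a c) -addrA addrC (le_trans (ler_normD _ _))// lerD//.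
by apply/ltW/Ud => //; exact: nbhs_singleton.
Qed.

(** A convex combination of families is tracked with the same error; where a
    coefficient vanishes nearby, its family may be arbitrary. *)
Lemma tracked_combination C e (D : seq X) (l : X -> X -> R)
    (c : forall y z : X, fiber B z) z :
  (forall y, y \in D -> {for z, continuous (l y)}) ->
  (forall y w, y \in D -> 0 <= l y w) ->
  (forall y, y \in D -> tracked C e (c y) (c y z) \/ \forall w \near z, l y w = 0) ->
  forall U : set (bspace B), nbhs (incl (\sum_(y <- D) scal (l y z) *: c y z)) U ->
    \forall w \near z, C w -> exists2 a : fiber B w, U (incl a) &
      `|a - \sum_(y <- D) scal (l y w) *: c y w| <= scal (\sum_(y <- D) l y w) * e.
Proof.
elim: D => [|y D IH] cl l0 cD U.
  rewrite big_nil => /small_nbhs[d d0]; apply: filterS => w Uw Cw.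
  by exists 0; rewrite ?big_nil ?subrr ?normr0 ?scal0 ?mul0r//; apply: Uw; rewrite normr0.
rewrite big_cons => /add_nbhs[U1 [U2 [yU1 DU2 U12]]].
have {IH} : \forall w \near z, C w -> exists2 a : fiber B w, U2 (incl a) &
      `|a - \sum_(y <- D) scal (l y w) *: c y w| <= scal (\sum_(y <- D) l y w) * e.
  apply: IH DU2 => [v vD|v w vD|v vD]; [apply: cl|apply: l0|apply: cD];
    by rewrite inE vD orbT.
have : \forall w \near z, C w -> exists2 a : fiber B w, U1 (incl a) &
      `|a - scal (l y w) *: c y w| <= scal (l y w) * e.
  have [cy|ly0] : tracked C e (c y) (c y z) \/ \forall w \near z, l y w = 0.
    by apply: cD; rewrite inE eqxx.
    have [A [U3 [lA cU3 AU]]] := scale_nbhs yU1.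
    have : \forall w \near z, A (scal (l y w)).
      have : {for z, continuous (scal \o l y : X -> K)}.
        apply: continuous_comp; last exact: scal_continuous.
        by apply: cl; rewrite inE eqxx.
      by apply.
    apply: filterS2 (cy _ cU3) => w aw Aw /aw[a aU3 ac].
    exists (scal (l y w) *: a); first exact: AU.
    rewrite -scalerBr normrZ scal_norm ger0_norm ?l0 ?inE ?eqxx//.
    by rewrite ler_wpM2l// -scal0 scal_le l0// inE eqxx.
  move: yU1; rewrite (nbhs_singleton ly0) scal0 scale0r => /small_nbhs[d d0].
  apply: filterS2 ly0 => w lw Uw Cw; exists 0; first by apply: Uw; rewrite normr0.
  by rewrite lw scal0 scale0r subrr normr0 mul0r.
apply: filterS2 => w + + Cw => /(_ Cw)[a aU1 ay] /(_ Cw)[b bU2 bD].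
exists (a + b); first exact: U12.
by rewrite !big_cons opprD addrACA (le_trans (ler_normD _ _))// scalD mulrDl lerD.
Qed.

End tracking.

Section refinement.
Context (R : realType) (s : scalars) (X : topologicalType).
Local Notation K := (scalar_field R s).
Context (B : banachBundle K X).
Hypotheses (hX : hausdorff_space X) (lX : locally_compact [set: X]).
Context (C : set X) (cC : compact C) (x : X) (u : fiber B x) (Cx : C x).

Definition tracked_through (e : K) (f : forall z, fiber B z) :=
  [/\ f x = u, tracked C e f u & forall y, C y -> exists c : fiber B y, tracked C e f c].

(** Replace [f] near each [y] by vectors chosen from a thin neighborhood of the
    value [c y] that [f] approximates.  Two vectors of such a neighborhood differ
    by at most [d], so every choice is tracked with error [d], with its own value
    as centre. *)
Lemma refine_tracking (e d : K) (f : forall z, fiber B z) : 0 <= e -> 0 < d ->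
  tracked_through e f ->
  exists2 f', tracked_through d f' & forall z, C z -> `|f' z - f z| <= e.
Proof.
move=> e0 d0 [fx fu fC].
(* Equality with [u] is stated in the total space, since the types [fiber B y] and
   [fiber B x] differ. *)
have /dependent_function_choice[c cP] : forall y, exists c : fiber B y,
    (C y -> tracked C e f c) /\ (y = x -> incl c = incl u).
  move=> y; have [yx|yx] := pselect (y = x); first by subst y; exists u.
  have [Cy|nCy] := pselect (C y); last by exists 0.
  by have [c fc] := fC y Cy; exists c.
have /choice[U UP] : forall y, exists U : set (bspace B), [/\ open U, U (incl (c y)) &
    forall z (a b : fiber B z), U (incl a) -> U (incl b) -> `|a - b| < d].
  move=> y; have [U cU Ud] := thin_nbhs (c y) d0.
  exists U°; split; [exact: open_interior|exact: cU|].
  by move=> z a b /interior_subset Ua /interior_subset; exact: Ud.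
(* Excluding [x] from the charts of all other points keeps [f' x] equal to [u]. *)
pose V y := [set z | (C z -> exists2 a : fiber B z, U y (incl a) & `|a - f z| <= e) /\
  (y = x \/ z <> x)].
have nV y : C y -> nbhs y (V y).
  move=> Cy; apply: filterI.
    apply: (cP y).1 => //; apply: open_nbhs_nbhs; by have [] := UP y.
  have [yx|yx] := pselect (y = x); first by apply: nearW => z; left.
  have := hausdorff_nbhs_setC1 hX yx.
  by apply: filterS => z; right.
have /dependent_function_choice[c' c'P] : forall p : X * X, exists a : fiber B p.2,
    (V p.1 p.2 -> C p.2 -> U p.1 (incl a) /\ `|a - f p.2| <= e) /\
    (p.2 = x -> incl a = incl u).
  move=> [y z] /=; have [zx|zx] := pselect (z = x).
    subst z; exists u; split => // -[_ [yx|//]] _; rewrite -((cP y).2 yx).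
    by split; [have [] := UP y|rewrite fx subrr normr0].
  have [ [ [h _] Cz]|nV'] := pselect (V y z /\ C z); last first.
    by exists 0; split => // Vz Cz; exfalso; exact: nV'.
  by have [a Ua ae] := h Cz; exists a.
pose g y z : fiber B z := c' (y, z).
have gP y z : (V y z -> C z -> U y (incl (g y z)) /\ `|g y z - f z| <= e) /\
  (z = x -> incl (g y z) = incl u) by exact: (c'P (y, z)).
have [D [l [DC cl l0 [l1 lC] lV]]] := @real_partition_of_unity R X hX lX C V cC nV.
pose f' z := \sum_(y <- D) scal (l y z) *: g y z.
have f'x : f' x = u.
  rewrite /f' (eq_bigr (fun y => scal (l y x) *: u)) => [|y _].
    by rewrite -scaler_suml -scal_sum lC// scal1 scale1r.
  by congr (_ *: _); apply: (@incl_inj _ _ B x); exact: (gP y x).2.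
have f'C z : C z -> tracked C d f' (f' z).
  move=> Cz W zW.
  have Wt : \forall w \near z, C w -> exists2 a : fiber B w, W (incl a) &
      `|a - f' w| <= scal (\sum_(y <- D) l y w) * d.
    apply: (@tracked_combination _ _ _ B C d D l g).
    - by move=> y yD; exact: cl.
    - by move=> y w yD; exact: l0.
    - move=> y yD; have [Vz|] := lV y z yD; last by right.
      left=> W' zW'.
      have Uz : U y (incl (g y z)).
        by have [] := (gP y z).1 (nbhs_singleton Vz) Cz.
      have : nbhs (incl (g y z)) (W' `&` U y).
        apply: filterI => //; apply: open_nbhs_nbhs; split => //; by have [] := UP y.
      move=> /fiberwise_nbhs; apply: filterS2 Vz => w Vw [a [aW aU]] Cw.
      exists a => //; apply/ltW; have [_ _] := UP y; apply => //.
      by have [] := (gP y w).1 Vw Cw.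
    - exact: zW.
  apply: filterS Wt => w Ww Cw; have [a Wa ae] := Ww Cw; exists a => //.
  by rewrite lC// scal1 mul1r in ae.
exists f'.
  split => //; first by rewrite -f'x; exact: f'C.
  by move=> y Cy; exists (f' y); exact: f'C.
move=> z Cz; have -> : f z = \sum_(y <- D) scal (l y z) *: f z.
  by rewrite -scaler_suml -scal_sum lC// scal1 scale1r.
rewrite /f' -sumrB; apply: le_trans (ler_norm_sum _ _ _) _.
have -> : e = \sum_(y <- D) scal (l y z) * e.
  by rewrite -mulr_suml -scal_sum lC// scal1 mul1r.
rewrite !big_seq; apply: ler_sum => y yD.
rewrite -scalerBr normrZ scal_norm ger0_norm ?l0//.
have [Vz|/nbhs_singleton->] := lV y z yD; last by rewrite scal0 !mul0r.
rewrite ler_wpM2l//; first by rewrite -scal0 scal_le l0.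
by have [] := (gP y z).1 (nbhs_singleton Vz) Cz.
Qed.


Lemma halving_small (r0 r : R) : 0 < r -> exists n, r0 / 2 ^+ n < r.
Proof.
move=> r_gt0; exists (Num.bound (r0 / r)).
rewrite ltr_pdivrMr ?exprn_gt0// mulrC -ltr_pdivrMr//.
exact: upper_nthrootP.
Qed.

(** A uniform limit of families with tracking errors tending to [0] is
    continuous on [C]. *)
Lemma tracked_limit (r0 : R) (f : nat -> forall z, fiber B z) : 0 <= r0 ->
  (forall n, tracked_through (scal (r0 / 2 ^+ n)) (f n)) ->
  (forall n z, C z -> `|f n.+1 z - f n z| <= scal (r0 / 2 ^+ n)) ->
  exists2 F : forall z, fiber B z, F x = u &
    forall y, C y -> forall U, nbhs (incl (F y)) U ->
      \forall z \near y, C z -> U (incl (F z)).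
Proof.
move=> r0_ge0 fT fS; pose e n := r0 / 2 ^+ n.
have e_ge0 n : 0 <= e n by rewrite divr_ge0// exprn_ge0.
have eS n : e n = 2 * e n.+1.
  by rewrite /e exprS; field; rewrite expf_neq0.
have dist n k z : C z -> `|f (n + k)%N z - f n z| <= scal (2 * e n - 2 * e (n + k)%N).
  move=> Cz; elim: k => [|k IH]; first by rewrite addn0 !subrr normr0 scal0.
  rewrite addnS -(subrK (f (n + k)%N z) (f (n + k).+1 z)) -addrA.
  rewrite (le_trans (ler_normD _ _))//; apply: le_trans (lerD (fS _ _ Cz) IH) _.
  by rewrite -scalD scal_le -/(e _) [X in X + _ <= _]eS; have := eS (n + k)%N; lra.
have dist2 n m z : C z -> (n <= m)%N -> `|f m z - f n z| <= scal (2 * e n).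
  move=> Cz nm; rewrite -(subnKC nm); apply: le_trans (dist _ _ _ Cz) _.
  by rewrite scal_le; have := e_ge0 (n + (m - n))%N; lra.
have small (d : K) : 0 < d -> exists n, scal (3 * e n) < d.
  move=> d0; have [r dr] := scal_surj (ltW d0).
  have r_gt0 : 0 < r by rewrite -(scal_lt (s := s)) -dr scal0.
  have [n nr] := halving_small (3 * r0) r_gt0; exists n.
  by rewrite dr scal_lt /e mulrA.
pose F z : fiber B z := lim (f n z @[n --> \oo]).
have cF z : C z -> f n z @[n --> \oo] --> F z.
  move=> Cz; apply: cauchy_cvg; apply: cauchy_exP => d d0.
  have [n nd] := small d d0; exists (f n z); exists n => // m /= nm.
  rewrite -ball_normE /ball_/= distrC (le_lt_trans _ nd)//.
  by rewrite (le_trans (dist2 _ _ _ Cz nm))// scal_le; have := e_ge0 n; lra.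
have FD n z : C z -> `|F z - f n z| <= scal (2 * e n).
  move=> Cz; apply/ler_addgt0Pr => d d0.
  have /cvgrPdist_lt/(_ d d0)[m _ mF] := cF z Cz.
  rewrite -(subrK (f (maxn n m) z) (F z)) -addrA addrC.
  rewrite (le_trans (ler_normD _ _))// lerD//.
    by apply: dist2 => //; exact: leq_maxl.
  by apply/ltW/mF => /=; exact: leq_maxr.
exists F.
  apply/eqP; rewrite -subr_eq0 -normr_le0; apply/ler_addgt0Pr => d d0.
  have [n nd] := small d d0; have [fx _ _] := fT n.
  rewrite add0r -{1}fx (le_trans (FD n x Cx))// (le_trans _ (ltW nd))// scal_le.
  by have := e_ge0 n; lra.
(* The centre [c] of [f n] at [y] is within [e n] of [f n y], hence within
   [3 * e n] of [F y]; the same bound compares [F z] with a vector near [c]. *)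
move=> y Cy U yU; have [U1 [d [yU1 d0 dU]]] := tube_nbhs yU.
have : nbhs (F y) (@incl _ _ B y @^-1` U1°).
  exact: (@incl_continuous _ _ B y (F y) _ (nbhs_interior yU1)).
case/nbhs_ballP => d' /= d'0 ballU1.
have [n nd] : exists n, scal (3 * e n) < Num.min d d'.
  apply: small; rewrite comparable_lt_min ?d0//.
  by rewrite real_comparable// ger0_real// ltW.
have dd : (d >=< d')%R by rewrite real_comparable// ger0_real// ltW.
move: nd; rewrite comparable_lt_min// => /andP[nd nd'].
have [_ _ /(_ y Cy)[c fc]] := fT n.
have e3 : scal (3 * e n) = scal (e n) + scal (2 * e n) :> K.
  by rewrite -scalD; congr scal; lra.
have cU1 : nbhs (incl c) U1.
  apply: ballU1; rewrite -ball_normE /ball_/= (le_lt_trans _ nd')// e3.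
  rewrite -(subrK (f n y) (F y)) -addrA addrC (le_trans (ler_normD _ _))// lerD//.
    by rewrite distrC; exact: tracked_dist fc.
  exact: FD.
apply: filterS (fc _ cU1) => z az Cz; have [a aU1 ae] := az Cz.
apply: dU aU1 _; rewrite (le_lt_trans _ nd)// e3.
rewrite -(subrK (f n z) (F z)) -addrA addrC (le_trans (ler_normD _ _))// lerD//.
  by rewrite distrC.
exact: FD.
Qed.

(** The first approximation takes the value [u] at [x] and [0] elsewhere: its
    error is at most [`|u| + 1]. *)
Lemma section_on_compact : exists2 F : forall z, fiber B z, F x = u &
    forall y, C y -> forall U, nbhs (incl (F y)) U ->
      \forall z \near y, C z -> U (incl (F z)).
Proof.
have [r0 r0E] : exists r0, `|u| + 1 = scal r0 by apply: scal_surj; rewrite addr_ge0.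
have r0_ge0 : 0 <= r0 by rewrite -(scal_le (s := s)) -r0E scal0 addr_ge0.
have /dependent_function_choice[f0 f0P] : forall z, exists a : fiber B z,
    (z = x -> incl a = incl u) /\ (z <> x -> a = 0).
  move=> z.
  by have [zx|zx] := pselect (z = x); [subst z; exists u|exists 0].
have f0x : f0 x = u by apply: (@incl_inj _ _ B x); exact: (f0P x).1.
have f0u : tracked C (`|u| + 1) f0 u.
  move=> U uU; have [W uW Wn] := norm_nbhs u ltr01.
  have : nbhs (incl u) (U `&` W) by exact: filterI.
  move=> /fiberwise_nbhs; apply: filterS => z [a [aU aW]] _.
  have [zx|zx] := pselect (z = x).
    subst z; exists u; first exact: nbhs_singleton.
    by rewrite f0x subrr normr0 addr_ge0.
  exists a => //; rewrite (f0P z).2// subr0 -lerBlDl.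
  apply: le_trans (ltW (Wn _ _ aW)); rewrite distrC.
  by apply: real_ler_norm; rewrite realB// normr_real.
have f0T : tracked_through (scal (r0 / 2 ^+ 0)) f0.
  rewrite expr0 divr1 -r0E; split => // y Cy.
  have [yx|yx] := pselect (y = x).
    have E : exists c : fiber B y, tracked C (`|u| + 1) f0 c by rewrite yx; exists u.
    exact: E.
  exists 0 => U /small_nbhs[d d0].
  have := hausdorff_nbhs_setC1 hX yx.
  apply: filterS2 => z /= zx Uz Cz; exists 0; first by apply: Uz; rewrite normr0.
  by rewrite (f0P z).2// subrr normr0 addr_ge0.
have /choice[step stepP] : forall p : nat * (forall z, fiber B z), exists f',
    tracked_through (scal (r0 / 2 ^+ p.1)) p.2 ->
    tracked_through (scal (r0 / 2 ^+ p.1.+1)) f' /\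
    forall z, C z -> `|f' z - p.2 z| <= scal (r0 / 2 ^+ p.1).
  move=> [n f] /=.
  have [fT|nfT] := pselect (tracked_through (scal (r0 / 2 ^+ n)) f); last first.
    by exists f.
  have [||f' f'T f'f] := @refine_tracking _ (scal (r0 / 2 ^+ n.+1)) _ _ _ fT.
  - by rewrite -scal0 scal_le divr_ge0// exprn_ge0.
  - rewrite -scal0 scal_lt divr_gt0// ?exprn_gt0//.
    by rewrite -(scal_lt (s := s)) -r0E scal0 ltr_wpDl.
  - by exists f'.
pose f := fix f n := if n is n'.+1 then step (n', f n') else f0.
have fT n : tracked_through (scal (r0 / 2 ^+ n)) (f n).
  by elim: n => [|n IH] //=; have [] := stepP (n, f n) IH.
apply: (@tracked_limit r0 f) => // n z Cz.
by have [_] := stepP (n, f n) (fT n); apply.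
Qed.

End refinement.

(** * Sections vanishing at infinity *)

Record unit_function (R : realType) (X : topologicalType) := UnitFunction {
  unit_fun :> X -> R ;
  unit_continuous : continuous unit_fun ;
  unit_range : forall z, 0 <= unit_fun z <= 1
}.

Section multiplication.
Context (R : realType) (s : scalars) (X : topologicalType).
Local Notation K := (scalar_field R s).
Context (B : banachBundle K X).
Implicit Types (h : unit_function R X) (f : section_space B).

Lemma unit_scal_continuous h : continuous (fun z => scal (h z) : K).
Proof.
move=> z; apply: (@continuous_comp X R K h scal).
  exact: unit_continuous.
exact: scal_continuous.
Qed.

Lemma unit_scal_norm h z : `|scal (h z) : K| = scal (h z).
Proof. by rewrite scal_norm ger0_norm//; have /andP[] := unit_range h z. Qed.

Lemma unit_scal_le1 h z : 0 <= (scal (h z) : K) <= 1.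
Proof. by rewrite -scal0 -scal1 !scal_le unit_range. Qed.

Lemma section_nbhs f z (U : set (bspace B)) :
  nbhs (incl (f z)) U -> \forall w \near z, U (incl (f w)).
Proof. exact: (@section_continuous _ _ B f z). Qed.

Lemma norm_section_near f z (e : K) : `|f z| < e -> \forall w \near z, `|f w| < e.
Proof.
move=> fe; have [U fU Ue] : exists2 U : set (bspace B), nbhs (incl (f z)) U &
    forall y (a : fiber B y), U (incl a) -> `|a| < e.
  have [U fU Un] := @norm_nbhs _ _ B z (f z) (e - `|f z|) ltac:(by rewrite subr_gt0).
  exists U => // y a /Un; rewrite distrC => h.
  rewrite -(subrK `|f z| `|a|) -ltrBrDr; apply: le_lt_trans h.
  by apply: real_ler_norm; rewrite realB// normr_real.
by apply: filterS (section_nbhs fU) => w; exact: Ue.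
Qed.

Lemma mul_continuous_at (C : set X) (F : forall z, fiber B z) h z :
  (forall U, nbhs (incl (F z)) U -> \forall w \near z, C w -> U (incl (F w))) ->
  forall U, nbhs (incl (scal (h z) *: F z)) U ->
    \forall w \near z, C w -> U (incl (scal (h w) *: F w)).
Proof.
move=> FC U /scale_nbhs[A [U1 [hA FU1 AU]]].
have hA' : \forall w \near z, A (scal (h w)) by exact: (@unit_scal_continuous h z).
apply: filterS2 hA' (FC _ FU1) => w Aw Uw Cw.
by apply: AU => //; exact: Uw.
Qed.

Lemma section_mul_continuous h f : continuous (fun z => incl (scal (h z) *: f z)).
Proof.
move=> z U /(@mul_continuous_at setT) /=.
move=> /(_ (fun V fV => filterS (fun w Vw _ => Vw) (section_nbhs fV))).
by apply: filterS => w; exact.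
Qed.

Lemma norm_mul_le h f z : `|scal (h z) *: f z| <= `|f z|.
Proof.
by rewrite normrZ unit_scal_norm ler_piMl//; have /andP[] := unit_scal_le1 h z.
Qed.

Lemma section_mul_vanishes h f : vanishes_at_infinity (fun z => scal (h z) *: f z).
Proof.
move=> e /(section_vanishes f)[A cA fA]; exists A => // z /fA.
exact/le_lt_trans/norm_mul_le.
Qed.

Definition section_mul h f :=
  Section (@section_mul_continuous h f) (@section_mul_vanishes h f).

End multiplication.

Section sections_exist.
Context (R : realType) (s : scalars) (X : topologicalType).
Local Notation K := (scalar_field R s).
Context (B : banachBundle K X).
Hypotheses (hX : hausdorff_space X) (lX : locally_compact [set: X]).

Lemma unit_bump (x : X) (V : set X) : nbhs x V ->
  exists h : unit_function R X, h x = 1 /\ forall z, ~ V z -> h z = 0.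
Proof.
move=> /(@real_bump R X hX lX)[f [cf f01 fx fV]].
by exists (UnitFunction cf f01).
Qed.

Lemma zero_near z (U : set (bspace B)) : nbhs (incl (0 : fiber B z)) U ->
  \forall w \near z, U (incl (0 : fiber B w)).
Proof. exact: (@zero_section_continuous _ _ B z). Qed.

(** Douady and dal Soglio-Herault: cut off a section over a compact neighborhood
    of [x]. *)
Lemma enough_sections x (u : fiber B x) : exists f : section_space B, f x = u.
Proof.
have [C [cC clC xC]] := compact_nbhs lX x.
have [F Fx FC] := section_on_compact hX lX cC u (nbhs_singleton xC).
have [h [hx hC]] := unit_bump xC.
have cf : continuous (fun z => incl (scal (h z) *: F z)).
  move=> z U zU; have [hz|hz] := eqVneq (h z) 0.
    move: (zU); rewrite hz scal0 scale0r => /zero_near U0.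
    have [Cz|nCz] := pselect (C z).
      have := mul_continuous_at (FC z Cz) zU.
      apply: filterS2 U0 => w U0 UC.
      have [/UC//|/hC hw] := pselect (C w).
      by rewrite /= hw scal0 scale0r.
    have : nbhs z (~` C) by apply: open_nbhs_nbhs; split => //; exact: closed_openC.
    by apply: filterS2 U0 => w U0 /hC hw; rewrite /= hw scal0 scale0r.
  have hn : \forall w \near z, h w != 0.
    exact: (@cvgr_neq0 R R^o _ _ _ _ (h z) (@unit_continuous _ _ h z) hz).
  have CC w : h w != 0 -> C w by apply: contraNP => /hC ->.
  have := mul_continuous_at (FC z (CC _ hz)) zU.
  by apply: filterS2 hn => w /CC Cw; apply.
have vf : vanishes_at_infinity (fun z => scal (h z) *: F z).
  by move=> e e0; exists C => // z /hC ->; rewrite scal0 scale0r normr0.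
by exists (Section cf vf); rewrite /= hx scal1 scale1r.
Qed.

Lemma section_through (b : bspace B) :
  exists p : X * section_space B, incl (p.2 p.1) = b.
Proof.
have [u <-] := @incl_surj _ _ B (bproj b) b erefl.
by have [f fu] := enough_sections u; exists (bproj b, f); rewrite /= fu.
Qed.

End sections_exist.


(** * Multipliers transported by an isometry *)

(** The upper bound suffices: if [`|A| >= `|B|], then
    [2 * `|A| <= `|A + B| + `|A - B| <= `|A + B| + `|A|], so that
    [`|A| <= `|A + B|]. *)
Lemma maximum_norm_copy (K : numFieldType) (E : normedModType K) (a b : E) :
  a != 0 -> b != 0 ->
  (forall (k l r : K), `|k *: a| <= r -> `|l *: b| <= r -> `|k *: a + l *: b| <= r) ->
  exists L : {linear (K^o * K^o)%type -> E}, forall p, `|L p| = `|p|.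
Proof.
move=> a0 b0 ab; have na : `|a| != 0 by rewrite normr_eq0.
have nb : `|b| != 0 by rewrite normr_eq0.
pose L0 (p : (K^o * K^o)%type) : E := (p.1 / `|a|) *: a + (p.2 / `|b|) *: b.
have L0_linear : linear L0.
  move=> k p q; rewrite /L0 /= scalerDr !scalerA addrACA -!scalerDl.
  by congr (_ *: _ + _ *: _); rewrite -[_ *: _]/(_ * _) mulrDl mulrA.
pose L : {linear (K^o * K^o)%type -> E} :=
  HB.pack_for {linear (K^o * K^o)%type -> E} L0
    (GRing.isLinear.Build K (K^o * K^o)%type E _ L0 L0_linear).
exists L => -[k l]; rewrite prod_normE /= /L0 /=.
have nk (c : K) (v : E) : `|v| != 0 -> `|(c / `|v|) *: v| = `|c|.
  by move=> v0; rewrite normrZ normf_div normr_id divfK.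
have half (A B : E) : `|A + B| <= `|A| -> `|A - B| <= `|A| -> `|A + B| = `|A|.
  move=> AB1 AB2; apply/eqP; rewrite eq_le AB1 /=.
  rewrite -(lerD2r `|A|) (le_trans _ (lerD (lexx _) AB2))//.
  apply: le_trans (ler_normD _ _); rewrite addrACA subrr addr0 -mulr2n.
  by rewrite normrMn mulr2n.
have [lk|/ltW kl] := real_leP (normr_real l) (normr_real k).
  rewrite -(nk k a na); apply: half.
    by apply: ab => //; rewrite !nk.
  by rewrite -scaleNr -mulNr; apply: ab => //; rewrite !nk// normrN.
rewrite -(nk l b nb) addrC; apply: half.
  by rewrite addrC; apply: ab => //; rewrite !nk.
rewrite -normrN opprB -scaleNr -mulNr.
by apply: ab => //; rewrite ?nk// normrN.
Qed.

Section section_evaluation.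
Context (R : realType) (s : scalars) (X : topologicalType).
Local Notation K := (scalar_field R s).
Context (B : banachBundle K X).
Implicit Types (f g : section_space B) (h : unit_function R X).

Lemma section_addE f g x : (f + g) x = f x + g x. Proof. by []. Qed.
Lemma section_scaleE (k : K) f x : (k *: f) x = k *: f x. Proof. by []. Qed.
Lemma section_oppE f x : (- f) x = - f x.
Proof. by rewrite -[LHS]/((-1) *: f x) scaleN1r. Qed.
Lemma section_sumE (I : Type) (D : seq I) (F : I -> section_space B) x :
  (\sum_(i <- D) F i) x = \sum_(i <- D) F i x.
Proof. by apply: (big_morph (fun f : section_space B => f x)). Qed.

Lemma section_norm_ge f x : `|f x| <= `|f|. Proof. exact: section_norm_ub. Qed.
Lemma section_norm_le_bound f (r : K) : 0 <= r -> (forall x, `|f x| <= r) -> `|f| <= r.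
Proof. exact: section_norm_le. Qed.

Lemma section_mulE h f x : section_mul h f x = scal (h x) *: f x. Proof. by []. Qed.
Lemma section_mulD h f g : section_mul h (f + g) = section_mul h f + section_mul h g.
Proof. by apply: section_ext => x; rewrite section_addE !section_mulE scalerDr. Qed.
Lemma section_mulZ h k f : section_mul h (k *: f) = k *: section_mul h f.
Proof.
by apply: section_ext => x; rewrite section_scaleE !section_mulE !scalerA mulrC.
Qed.

End section_evaluation.

Section isometry.
Context (R : realType) (s : scalars) (X Y : topologicalType).
Local Notation K := (scalar_field R s).
Context (BX : banachBundle K X) (BY : banachBundle K Y).
Hypotheses (hX : hausdorff_space X) (lX : locally_compact [set: X]).
Hypotheses (hY : hausdorff_space Y) (lY : locally_compact [set: Y]).
Context (T : {linear section_space BX -> section_space BY})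
        (T' : {linear section_space BY -> section_space BX}).
Hypotheses (T'K : cancel T' T) (T_norm : forall f, `|T f| = `|f|).
Implicit Types (f g k : section_space BX) (h : unit_function R Y).

Definition transported_mul h f := T' (section_mul h (T f)).
Local Notation S := transported_mul.

Lemma transported_mulD h f g : S h (f + g) = S h f + S h g.
Proof. by rewrite /S linearD section_mulD linearD. Qed.
Lemma transported_mulZ h (c : K) f : S h (c *: f) = c *: S h f.
Proof. by rewrite /S linearZ section_mulZ linearZ. Qed.

Lemma inverse_norm (g : section_space BY) : `|T' g| = `|g|.
Proof. by rewrite -T_norm T'K. Qed.

(** Over [Y], [T k - h * T f] is the convex combination of [T k] and [T (k - f)]
    with weights [1 - h] and [h]. *)
Lemma transported_mul_ball h f k (r : K) :
  `|k| <= r -> `|k - f| <= r -> `|k - S h f| <= r.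
Proof.
move=> kr kfr; have r0 := le_trans (normr_ge0 _) kr.
rewrite -T_norm linearB /= T'K; apply: section_norm_le_bound => // y.
rewrite section_addE section_oppE section_mulE.
have -> : T k y - scal (h y) *: T f y =
    scal (1 - h y) *: T k y + scal (h y) *: (T k - T f) y.
  rewrite section_addE section_oppE scalerBr scalB scal1 scalerBl scale1r.
  by rewrite addrA subrK.
have /andP[h0 h1] := unit_range h y.
rewrite (le_trans (ler_normD _ _))// !normrZ !scal_norm !ger0_norm ?subr_ge0//.
have -> : r = scal (1 - h y) * r + scal (h y) * r.
  by rewrite -mulrDl -scalD subrK scal1 mul1r.
apply: lerD; apply: ler_wpM2l.
- by rewrite -scal0 scal_le subr_ge0.
- by rewrite (le_trans (section_norm_ge _ _))// T_norm.
- by rewrite -scal0 scal_le.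
- by rewrite (le_trans (section_norm_ge _ _))// -linearB T_norm.
Qed.

(** Let [u = S h f x] be nonzero, and take [k = - t * p * S h f] with [p] a bump at
    [x] supported where [f] is small and [S h f] is hardly larger than [u].  If
    [t * `|u|] exceeds the norm of [f], both [k] and [k - f] have norm at most
    [t * `|u|] up to a small error, but [k - S h f] has norm [(t + 1) * `|u|] at
    [x]. *)
Lemma transported_mul_local h f x : f x = 0 -> S h f x = 0.
Proof.
move=> fx; apply/eqP/negPn/negP => u0; set u := S h f x in u0.
have nu : 0 < `|u| by rewrite normr_gt0.
pose t : K := (`|f| + 1) / `|u|.
have t0 : 0 < t by rewrite divr_gt0// ltr_wpDl.
have tu : `|f| <= t * `|u| by rewrite divfK ?gt_eqF// lerDl.
have t1 : 0 < t + 1 by rewrite addr_gt0.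
(* Chosen so that the total error [t * e + e] is half of [`|u|]. *)
pose e : K := `|u| / 2 / (t + 1).
have e0 : 0 < e by rewrite !divr_gt0.
have et : t * e + e = `|u| / 2.
  by rewrite -[X in _ + X]mul1r -mulrDl mulrC /e divfK ?gt_eqF.
have V1 : \forall w \near x, `|S h f w| < `|u| + e.
  by apply: norm_section_near; rewrite ltrDl.
have V2 : \forall w \near x, `|f w| < e.
  by apply: norm_section_near; rewrite fx normr0.
have [p [px pV]] := @unit_bump R X hX lX x _ (filterI V1 V2).
pose k := (- t) *: section_mul p (S h f).
have ue0 : 0 <= t * (`|u| + e) by rewrite mulr_ge0 ?addr_ge0// ltW.
have kV w : `|k w| <= t * (`|u| + e).
  rewrite section_scaleE section_mulE normrZ normrN gtr0_norm//.
  have [[w1 _]|/pV pw] := pselect (`|S h f w| < `|u| + e /\ `|f w| < e).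
    by rewrite ler_wpM2l ?(ltW t0)// (le_trans (norm_mul_le p (S h f) w))// ltW.
  by rewrite pw scal0 scale0r normr0 mulr0.
have kr : `|k| <= t * (`|u| + e) + e.
  apply: section_norm_le_bound => [|w]; first by rewrite addr_ge0// ltW.
  by rewrite (le_trans (kV w))// lerDl ltW.
have kfr : `|k - f| <= t * (`|u| + e) + e.
  apply: section_norm_le_bound => [|w]; first by rewrite addr_ge0// ltW.
  rewrite section_addE section_oppE.
  have [[_ w2]|/pV pw] := pselect (`|S h f w| < `|u| + e /\ `|f w| < e).
    by rewrite (le_trans (ler_normB _ _))// lerD// ltW.
  rewrite section_scaleE section_mulE pw scal0 scale0r scaler0 sub0r normrN.
  rewrite (le_trans (section_norm_ge f w))// (le_trans tu)// mulrDr -addrA lerDl.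
  by rewrite et divr_ge0.
have := le_trans (section_norm_ge _ x) (transported_mul_ball h kr kfr).
rewrite section_addE section_oppE section_scaleE section_mulE px scal1 scale1r -/u.
rewrite -[X in _ - X]scale1r -scalerBl normrZ -opprD normrN gtr0_norm// mulrDl mul1r.
rewrite mulrDr -addrA lerD2l et => h2.
have : `|u| < `|u|.
  by apply: le_lt_trans h2 _; rewrite ltr_pdivrMr// ltr_pMr// ltr1n.
by rewrite ltxx.
Qed.

(** At [z], [p * f] and [p z * f] have the same value, so locality applies to
    their difference. *)
Lemma transported_mul_comm h (p : unit_function R X) f :
  S h (section_mul p f) = section_mul p (S h f).
Proof.
apply: section_ext => z; apply/eqP; rewrite -subr_eq0 section_mulE.
have := @transported_mul_local h (section_mul p f + (- scal (p z)) *: f) z.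
rewrite transported_mulD transported_mulZ !section_addE !section_scaleE section_mulE.
by rewrite !scaleNr subrr => ->.
Qed.

(** Over [Y] the two sections have disjoint supports, so the norm of their sum is
    the maximum of their norms.  This is a statement on global norms; since the
    transported multipliers commute with a bump [p] at [x], it can be localized
    at [x]. *)
Lemma transported_mul_disjoint h1 h2 f1 f2 x (r : K) :
  (forall y, h1 y = 0 \/ h2 y = 0) ->
  `|S h1 f1 x| <= r -> `|S h2 f2 x| <= r -> `|S h1 f1 x + S h2 f2 x| <= r.
Proof.
move=> h12 r1 r2; have r0 := le_trans (normr_ge0 _) r1.
apply/ler_addgt0Pr => e e0; have re0 : 0 <= r + e by rewrite addr_ge0// ltW.
have V1 : \forall w \near x, `|S h1 f1 w| < r + e.
  by apply: norm_section_near; rewrite (le_lt_trans r1)// ltrDl.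
have V2 : \forall w \near x, `|S h2 f2 w| < r + e.
  by apply: norm_section_near; rewrite (le_lt_trans r2)// ltrDl.
have [p [px pV]] := @unit_bump R X hX lX x _ (filterI V1 V2).
have small f h : (forall w, `|S h1 f1 w| < r + e /\ `|S h2 f2 w| < r + e ->
      `|S h f w| < r + e) ->
    forall y, `|section_mul h (T (section_mul p f)) y| <= r + e.
  move=> small y; apply: le_trans (section_norm_ge _ y) _.
  rewrite -inverse_norm -/(S h _) transported_mul_comm.
  apply: section_norm_le_bound => // w; rewrite section_mulE.
  have [/small w1|/pV pw] := pselect (`|S h1 f1 w| < r + e /\ `|S h2 f2 w| < r + e).
    exact: (le_trans (norm_mul_le p (S h f) w)) (ltW w1).
  by rewrite pw scal0 scale0r normr0.
have -> : S h1 f1 x + S h2 f2 x =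
    (T' (section_mul h1 (T (section_mul p f1)) + section_mul h2 (T (section_mul p f2)))) x.
  rewrite linearD section_addE -/(S h1 _) -/(S h2 _) !transported_mul_comm.
  by rewrite !section_mulE px scal1 !scale1r.
apply: le_trans (section_norm_ge _ x) _; rewrite inverse_norm.
apply: section_norm_le_bound => // y; rewrite section_addE.
have [hy|hy] := h12 y.
  by rewrite section_mulE hy scal0 scale0r add0r small// => w [].
by rewrite [X in _ + X]section_mulE hy scal0 scale0r addr0 small// => w [].
Qed.

(** The representation [h |-> S h] at the fiber over [x] is a representation of
    an algebra of functions on [Y]; this is its support. *)
Definition in_support (x : X) (y : Y) := forall W : set Y, nbhs y W ->
  exists2 h : unit_function R Y, (forall z, ~ W z -> h z = 0) & exists f, S h f x != 0.

Lemma in_support_unique x y y' : nonsquare (fiber BX x) ->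
  in_support x y -> in_support x y' -> y = y'.
Proof.
move=> nsq sy sy'; apply: contrapT => /eqP yy'.
have := hY; rewrite open_hausdorff => /(_ y y' yy').
move=> [ [W W'] /= [yW yW'] [oW oW' /eqP WW']].
move/set_mem: yW => yW; move/set_mem: yW' => yW'.
have [h1 h1W [f1 f1x]] := sy W (open_nbhs_nbhs (conj oW yW)).
have [h2 h2W [f2 f2x]] := sy' W' (open_nbhs_nbhs (conj oW' yW')).
apply: nsq; apply: (maximum_norm_copy f1x f2x) => k l r.
rewrite -!section_scaleE -!transported_mulZ; apply: transported_mul_disjoint => z.
have [Wz|/h1W] := pselect (W z); last by left.
right; apply: h2W => W'z; suff : set0 z by [].
by rewrite -WW'.
Qed.

End isometry.



(** * The point map of an isometry *)

Section isometry_point_map.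
Context (R : realType) (s : scalars) (X Y : topologicalType).
Local Notation K := (scalar_field R s).
Context (BX : banachBundle K X) (BY : banachBundle K Y).
Hypotheses (hX : hausdorff_space X) (lX : locally_compact [set: X]).
Hypotheses (hY : hausdorff_space Y) (lY : locally_compact [set: Y]).
Hypotheses (nzX : nonzero_fibers BX) (nsX : nonsquare_bundle BX).
Context (T : {linear section_space BX -> section_space BY})
        (T' : {linear section_space BY -> section_space BX}).
Hypotheses (T'K : cancel T' T) (T_norm : forall f, `|T f| = `|f|).

Lemma norm_sublevel_compact (g : section_space BY) (r : K) : 0 < r ->
  compact [set y | r <= `|g y|].
Proof.
move=> r0; have [A cA gA] := section_vanishes g r0.
have rE y : ~ (r <= `|g y|) -> `|g y| < r.
  by move/negP; rewrite -real_ltNge// ?normr_real// ger0_real// ltW.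
apply: (subclosed_compact _ cA); last first.
  by move=> y /= ry; apply: contrapT => /gA gr; have := le_lt_trans ry gr; rewrite ltxx.
rewrite -openC openE => y /rE /norm_section_near.
by apply: filterS => z gr /= rg; have := le_lt_trans rg gr; rewrite ltxx.
Qed.

(** Each point of the compact set where [`|T f| >= r] has a neighborhood [W] such
    that multipliers supported in [W] act trivially at [x].  By a partition of
    unity, subtracting from [T f] its part over this compact set does not change
    the value [f x], and leaves a section of norm at most [r]. *)
Lemma norm_le_off_support (x : X) (f : section_space BX) (r : K) : 0 < r ->
  (forall y, r <= `|T f y| -> ~ in_support T T' x y) -> `|f x| <= r.
Proof.
move=> r0 fr; pose C := [set y | r <= `|T f y|].
have /choice[W WP] : forall y, exists W : set Y, C y -> nbhs y W /\
    forall h : unit_function R Y, (forall z, ~ W z -> h z = 0) ->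
      forall g, transported_mul T T' h g x = 0.
  move=> y; have [Cy|nCy] := pselect (C y); last by exists setT.
  apply: contrapT => nW; apply: (fr y Cy) => W yW; apply: contrapT => nh.
  apply: nW; exists W => _; split => // h hW g; apply: contrapT => /eqP hg.
  by apply: nh; exists h => //; exists g.
have [D [l [DC cl l0 [l1 lC] lV]]] := @real_partition_of_unity R Y hY lY C W
  (@norm_sublevel_compact (T f) r r0) (fun y Cy => (WP y Cy).1).
have /choice[h hP] : forall y, exists h : unit_function R Y,
    y \in D -> forall z, h z = l y z.
  move=> y; have [yD|yD] := boolP (y \in D); last first.
    have c0 : continuous (fun _ : Y => 0 : R) by move=> ?; exact: cvg_cst.
    have r01 (z : Y) : 0 <= (0 : R) <= 1 by rewrite lexx ler01.
    by exists (UnitFunction c0 r01).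
  have r01 z : 0 <= l y z <= 1.
    rewrite l0//= (le_trans _ (l1 z))// (big_rem y yD)/= lerDl.
    rewrite big_seq; apply: sumr_ge0 => y' /mem_rem; exact: l0.
  by exists (UnitFunction (cl y yD) r01).
pose g := \sum_(y <- D) transported_mul T T' (h y) f.
have gx : g x = 0.
  rewrite section_sumE big_seq big1// => y yD.
  apply: (WP y (DC y yD)).2 => z nWz; rewrite hP//.
  by have [/nbhs_singleton//|/nbhs_singleton] := lV y z yD.
rewrite -[f x]subr0 -gx -section_oppE -section_addE.
apply: le_trans (section_norm_ge _ x) _; rewrite -T_norm linearB linear_sum /=.
apply: section_norm_le_bound; first exact: ltW.
move=> y; rewrite section_addE section_oppE section_sumE.
have -> : T f y - \sum_(i <- D) (T (transported_mul T T' (h i) f)) y =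
    scal (1 - \sum_(i <- D) l i y) *: T f y.
  rewrite scalB scal1 scalerBl scale1r; congr (_ - _).
  rewrite scal_sum scaler_suml !big_seq; apply: eq_bigr => i iD.
  by rewrite T'K section_mulE hP.
have [Cy|nCy] := pselect (C y).
  by rewrite lC// subrr scal0 scale0r normr0 ltW.
have Tr : `|T f y| <= r.
  move/negP: nCy; rewrite -real_ltNge ?normr_real// ?ger0_real ?(ltW r0)//.
  exact: ltW.
rewrite normrZ scal_norm ger0_norm ?subr_ge0// (le_trans _ Tr)//.
rewrite ler_piMl// -scal1 scal_le lerBlDl lerDr.
by rewrite big_seq sumr_ge0// => i; exact: l0.
Qed.

(** The support at [x] is not empty, since otherwise all sections would be
    arbitrarily small at [x]; it is then a single point [psi x], and
    [norm_le_off_support] applies with every [r > `|T f (psi x)|]. *)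
Lemma isometry_domination : exists psi : X -> Y,
  forall x (f : section_space BX), `|f x| <= `|T f (psi x)|.
Proof.
have /choice[psi psiP] : forall x, exists y, in_support T T' x y.
  move=> x; apply: contrapT => nsupp; have [u u0] := nzX x.
  have [f fu] := enough_sections hX lX u.
  have nu : 0 < `|u| by rewrite normr_gt0.
  have : `|f x| <= `|u| / 2.
    apply: norm_le_off_support; first by rewrite divr_gt0.
    by move=> y _ sy; apply: nsupp; exists y.
  rewrite fu ler_pdivlMr// => h2; have : `|u| < `|u|.
    by apply: lt_le_trans h2; rewrite ltr_pMr// ltr1n.
  by rewrite ltxx.
exists psi => x f; apply/ler_addgt0Pr => e e0.
apply: norm_le_off_support; first by rewrite ltr_wpDl.
move=> y ry sy; have xy : y = psi x.
  by apply: in_support_unique sy (psiP x) => //; exact: nsX.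
move: ry; rewrite xy gerDl => e_le0; have := lt_le_trans e0 e_le0; by rewrite ltxx.
Qed.

End isometry_point_map.



(** * From an isometry to a bundle isomorphism *)

Lemma sections_separate_points (R : realType) (s : scalars) (X : topologicalType)
    (B : banachBundle (scalar_field R s) X) (x x' : X) :
  hausdorff_space X -> locally_compact [set: X] -> nonzero_fibers B ->
  (forall f : section_space B, `|f x| <= `|f x'|) -> x = x'.
Proof.
move=> hX lX nzX fxx'; apply: contrapT => xx'; have [u u0] := nzX x.
have [f fu] := enough_sections hX lX u.
have [h [hx hV]] := @unit_bump R X hX lX _ _ (hausdorff_nbhs_setC1 hX xx').
have := fxx' (section_mul h f).
rewrite !section_mulE hx scal1 scale1r fu hV; last by apply.
by rewrite scal0 scale0r normr0 normr_le0 (negPf u0).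
Qed.

Section from_isometry.
Context (R : realType) (s : scalars) (X Y : topologicalType).
Local Notation K := (scalar_field R s).
Context (BX : banachBundle K X) (BY : banachBundle K Y).
Hypotheses (hX : hausdorff_space X) (lX : locally_compact [set: X]).
Hypotheses (hY : hausdorff_space Y) (lY : locally_compact [set: Y]).
Hypothesis (nzY : nonzero_fibers BY).
Context (T : {linear section_space BX -> section_space BY}) (psi : X -> Y).
Hypothesis T_surj : forall g, exists f, T f = g.
Hypothesis T_pointwise : forall x f, `|T f (psi x)| = `|f x|.

(** Given a neighborhood [V] of [psi x], a section supported in [V] and nonzero at
    [psi x] comes from a section [f], and [psi] maps the neighborhood of [x] where
    [f] does not vanish into [V]. *)
Lemma point_map_continuous : continuous psi.
Proof.
move=> x V /= xV; have [v v0] := nzY (psi x).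
have [g gv] := enough_sections hY lY v.
have [h [hx hV]] := @unit_bump R Y hY lY _ _ xV.
have [f fg] := T_surj (section_mul h g).
have fx : incl (f x) != incl (0 : fiber BX x).
  apply/eqP => /incl_inj fx; have := T_pointwise x f.
  rewrite fx fg section_mulE hx scal1 scale1r gv normr0 => /eqP.
  by rewrite normr_eq0 (negPf v0).
have fn0 : `|f x| != 0.
  by rewrite normr_eq0; apply: contraNneq fx => ->.
have : nbhs (incl (f x)) [set b | forall a : fiber BX (bproj b), incl a = b -> a != 0].
  have [|U fU Un] := @norm_nbhs _ _ BX x (f x) `|f x|; first by rewrite lt_def fn0 /=.
  apply: filterS fU => b Ub a ab; apply/eqP => a0.
  by have := Un _ a; rewrite ab a0 normr0 subr0 normr_id => /(_ Ub); rewrite ltxx.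
move=> /section_nbhs; apply: filterS => w /= fw.
apply: contrapT => /hV hw; have := T_pointwise w f.
rewrite fg section_mulE hw scal0 scale0r normr0 => /esym/eqP; rewrite normr_eq0 => fw0.
by move: fw; rewrite bproj_incl => /(_ (f w) erefl); rewrite fw0.
Qed.

Lemma section_values_determine x (f f' : section_space BX) :
  f x = f' x -> T f (psi x) = T f' (psi x).
Proof.
move=> ff'; apply/eqP; rewrite -subr_eq0 -section_oppE -section_addE -linearB.
by rewrite -normr_eq0 T_pointwise section_addE section_oppE ff' subrr normr0.
Qed.

(** Continuity at [incl (f x)]: a vector [incl (k w)] near it is close to
    [incl (f w)] in its fiber, so its image is close, in the norm, to
    [T f (psi w)], which depends continuously on [w]. *)
Lemma isometry_total_map : exists2 Phi : bspace BX -> bspace BY, continuous Phi &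
  forall (f : section_space BX) x, Phi (incl (f x)) = incl (T f (psi x)).
Proof.
have /choice[sec secE] := @section_through R s X BX hX lX.
pose Phi b := incl (T (sec b).2 (psi (sec b).1)).
have PhiE (f : section_space BX) x : Phi (incl (f x)) = incl (T f (psi x)).
  rewrite /Phi; have := secE (incl (f x)); move: (sec _) => [x' f'] /= E.
  have xx' : x' = x by rewrite -(bproj_incl (f x)) -E bproj_incl.
  by subst x'; congr incl; apply: section_values_determine; exact: incl_inj E.
exists Phi => // b0 O; have [[x f] /= <-] := section_through hX lX b0.
rewrite PhiE => /tube_nbhs[U1 [d [TU1 d0 dU]]].
have near1 : \forall w \near x, U1 (incl (T f (psi w))).
  exact: (point_map_continuous (section_nbhs TU1)).
have [U fU Ud] := @thin_nbhs _ _ BX x (f x) d d0.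
have near2 : \forall w \near x, U (incl (f w)) by exact: section_nbhs.
have near12 : \forall w \near x, U1 (incl (T f (psi w))) /\ U (incl (f w)).
  exact: filterI.
have := proj_nbhs (f x) near12.
apply: filterS2 fU => b Ub [w1 w2].
have [[x' k] /= kb] := section_through hX lX b.
move: Ub w1 w2; rewrite -kb bproj_incl /= => Ub w1 w2.
rewrite PhiE; apply: dU w1 _.
by rewrite -section_oppE -section_addE -linearB T_pointwise section_addE section_oppE Ud.
Qed.

Lemma isometry_fiber_map x : exists L : {linear fiber BX x -> fiber BY (psi x)},
  (forall f : section_space BX, L (f x) = T f (psi x)) /\ range L = setT.
Proof.
have /choice[sec secE] : forall u : fiber BX x, exists f : section_space BX, f x = u.
  by move=> u; exact: enough_sections.
pose L0 u : fiber BY (psi x) := T (sec u) (psi x).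
have L0E (f : section_space BX) : L0 (f x) = T f (psi x).
  by apply: section_values_determine; rewrite secE.
have L0_linear : linear L0.
  move=> a u v; rewrite -{1}(secE u) -{1}(secE v) -section_scaleE -section_addE L0E.
  by rewrite linearP.
pose L : {linear fiber BX x -> fiber BY (psi x)} :=
  HB.pack_for {linear fiber BX x -> fiber BY (psi x)} L0
    (GRing.isLinear.Build K (fiber BX x) (fiber BY (psi x)) _ L0 L0_linear).
exists L; split; first exact: L0E.
apply/seteqP; split => // v _; have [g gv] := enough_sections hY lY v.
by have [f fg] := T_surj g; exists (f x) => //; rewrite -gv -fg; exact: L0E.
Qed.

End from_isometry.

Lemma bundle_isomorphic_of_isometry (R : realType) (s : scalars) (X Y : topologicalType)
    (BX : banachBundle (scalar_field R s) X)
    (BY : banachBundle (scalar_field R s) Y) :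
  hausdorff_space X -> locally_compact [set: X] ->
  hausdorff_space Y -> locally_compact [set: Y] ->
  nonzero_fibers BX -> nonzero_fibers BY ->
  nonsquare_bundle BX -> nonsquare_bundle BY ->
  isometrically_isomorphic (section_space BX) (section_space BY) ->
  bundle_isomorphic BX BY.
Proof.
move=> hX lX hY lY nzX nzY nsX nsY [T [T_range T_norm]].
have /choice[T0 T0K] : forall g, exists f, T f = g.
  move=> g; have [f _ fg] : range T g by rewrite T_range.
  by exists f.
have T_inj : injective T.
  move=> f f' ff'; apply/eqP; rewrite -subr_eq0 -normr_eq0 -T_norm linearB /=.
  by rewrite ff' subrr normr0.
have T0_linear : linear T0.
  by move=> a g g'; apply: T_inj; rewrite linearP !T0K.
pose T' : {linear section_space BY -> section_space BX} :=
  HB.pack_for {linear section_space BY -> section_space BX} T0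
    (GRing.isLinear.Build _ (section_space BY) (section_space BX) _ T0 T0_linear).
have T'K : cancel T' T by exact: T0K.
have TK : cancel T T' by move=> f; apply: T_inj; rewrite T'K.
have T'_norm g : `|T' g| = `|g| by rewrite -T_norm T'K.
have [psi psiP] := isometry_domination hX lX hY lY nzX nsX T'K T_norm.
have [psi' psi'P] := isometry_domination hY lY hX lX nzY nsY TK T'_norm.
have psiK : cancel psi psi'.
  move=> x; apply/esym; apply: (@sections_separate_points R s X BX) => // f.
  by rewrite (le_trans (psiP x f))// (le_trans (psi'P _ _))// TK.
have psi'K : cancel psi' psi.
  move=> y; apply/esym; apply: (@sections_separate_points R s Y BY) => // f.
  by rewrite (le_trans (psi'P y f))// (le_trans (psiP _ _))// T'K.
have T_pt x (f : section_space BX) : `|T f (psi x)| = `|f x|.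
  apply/eqP; rewrite eq_le psiP andbT (le_trans (psi'P _ _))//.
  by rewrite TK psiK.
have T'_pt y (g : section_space BY) : `|T' g (psi' y)| = `|g y|.
  apply/eqP; rewrite eq_le psi'P andbT (le_trans (psiP _ _))//.
  by rewrite T'K psi'K.
have T_surj g : exists f, T f = g by exists (T' g).
have T'_surj f : exists g, T' g = f by exists (T f).
have cpsi := point_map_continuous hY lY nzY T_surj T_pt.
have cpsi' := point_map_continuous hX lX nzX T'_surj T'_pt.
have [Phi cPhi PhiE] := isometry_total_map hX lX hY lY nzY T_surj T_pt.
have [Phi' cPhi' Phi'E] := isometry_total_map hY lY hX lX nzX T'_surj T'_pt.
exists Phi, psi; split.
- split => //; exists Phi' => //; split => b.
    by have [[x f] /= <-] := section_through hX lX b; rewrite PhiE Phi'E TK psiK.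
  by have [[y g] /= <-] := section_through hY lY b; rewrite Phi'E PhiE T'K psi'K.
- by split => //; exists psi'.
- by move=> b; have [[x f] /= <-] := section_through hX lX b; rewrite PhiE !bproj_incl.
- move=> x; have [L [LE L_range]] := isometry_fiber_map hX lX hY lY T_surj T_pt x.
  exists L; split => // u; have [f fu] := enough_sections hX lX u.
    by rewrite -fu PhiE LE.
  by rewrite -fu LE T_pt.
Qed.



(** * From a bundle isomorphism to an isometry *)

Section section_transport.
Context (K : numFieldType) (X Y : topologicalType).
Context (BX : banachBundle K X) (BY : banachBundle K Y).
Context (Phi : bspace BX -> bspace BY) (psi : X -> Y) (g : Y -> X).
Hypotheses (cPhi : continuous Phi) (cpsi : continuous psi) (cg : continuous g).
Hypothesis gK : cancel g psi.
Hypothesis Phi_over : forall b, bproj (Phi b) = psi (bproj b).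
Hypothesis Phi_norm : forall x (u : fiber BX x) y (v : fiber BY y),
  Phi (incl u) = incl v -> `|v| = `|u|.

Lemma transported_section (f : section_space BX) :
  exists k : section_space BY, forall y, incl (k y) = Phi (incl (f (g y))).
Proof.
have /dependent_function_choice[k kE] :
    forall y, exists v : fiber BY y, incl v = Phi (incl (f (g y))).
  by move=> y; apply: incl_surj; rewrite Phi_over bproj_incl gK.
have ck : continuous (fun y => incl (k y)).
  rewrite (_ : (fun y => _) = Phi \o ((fun x => incl (f x)) \o g)); last first.
    by apply/funext => y; rewrite kE.
  move=> y; apply: continuous_comp; last exact: cPhi.
  by apply: continuous_comp; [exact: cg|exact: section_continuous].
have vk : vanishes_at_infinity k.
  move=> e /(section_vanishes f)[A cA fA]; exists (psi @` A).
    by apply: continuous_compact => //; exact: continuous_subspaceT.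
  move=> y Ay; rewrite (Phi_norm (esym (kE y))); apply: fA => Agy.
  by apply: Ay; exists (g y).
by exists (Section ck vk).
Qed.

End section_transport.

Lemma isometry_of_bundle_isomorphic (R : realType) (s : scalars) (X Y : topologicalType)
    (BX : banachBundle (scalar_field R s) X)
    (BY : banachBundle (scalar_field R s) Y) :
  bundle_isomorphic BX BY ->
  isometrically_isomorphic (section_space BX) (section_space BY).
Proof.
move=> [Phi [psi [[cPhi [Phi' cPhi' [PhiK Phi'K]]] [cpsi [g cg [psiK gK]]] Phi_over Phi_lin]]].
have Phi_norm x (u : fiber BX x) y (v : fiber BY y) :
    Phi (incl u) = incl v -> `|v| = `|u|.
  move=> uv; have [L [LE _ <-]] := Phi_lin x.
  have xy : psi x = y by rewrite -(bproj_incl v) -uv Phi_over bproj_incl.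
  by subst y; congr (`|_|); move: uv; rewrite LE => /incl_inj.
have Phi'_norm y (v : fiber BY y) x (u : fiber BX x) :
    Phi' (incl v) = incl u -> `|u| = `|v|.
  by move=> vu; apply/esym/Phi_norm; rewrite -vu Phi'K.
have Phi'_over c : bproj (Phi' c) = g (bproj c).
  by rewrite -{2}(Phi'K c) Phi_over psiK.
have /choice[T0 T0E] := transported_section cPhi cpsi cg gK Phi_over Phi_norm.
have T0_linear : linear T0.
  move=> a f f'; apply: section_ext => y; have <- : psi (g y) = y by [].
  have [L [LE _ _]] := Phi_lin (g y).
  have T0L (k : section_space BX) : T0 k (psi (g y)) = L (k (g y)).
    by apply: (@incl_inj _ _ BY); rewrite T0E psiK LE.
  by rewrite section_addE section_scaleE !T0L section_addE section_scaleE linearP.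
pose T : {linear section_space BX -> section_space BY} :=
  HB.pack_for {linear section_space BX -> section_space BY} T0
    (GRing.isLinear.Build _ (section_space BX) (section_space BY) _ T0 T0_linear).
exists T; split.
  apply/seteqP; split => // k _.
  have [f fE] := transported_section cPhi' cg cpsi psiK Phi'_over Phi'_norm k.
  exists f => //; apply: section_ext => y; apply: (@incl_inj _ _ BY).
  by rewrite T0E fE Phi'K gK.
move=> f; apply/eqP; rewrite eq_le; apply/andP; split.
  apply: section_norm_le_bound => // y.
  by rewrite (Phi_norm _ _ _ _ (esym (T0E f y))) section_norm_ge.
apply: section_norm_le_bound => // x.
have := T0E f (psi x); rewrite psiK => /esym/Phi_norm <-.
exact: (section_norm_ge (T0 f)).
Qed.

Theorem theorem1p3 (R : realType) (s : scalars) (X Y : topologicalType)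
    (BX : banachBundle (scalar_field R s) X)
    (BY : banachBundle (scalar_field R s) Y) :
  hausdorff_space X -> locally_compact [set: X]%classic ->
  hausdorff_space Y -> locally_compact [set: Y]%classic ->
  nonzero_fibers BX -> nonzero_fibers BY ->
  nonsquare_bundle BX -> nonsquare_bundle BY ->
  bundle_isomorphic BX BY <->
  isometrically_isomorphic (section_space BX) (section_space BY).
Proof.
move=> hX lX hY lY nzX nzY nsX nsY; split.
  exact: isometry_of_bundle_isomorphic.
exact: bundle_isomorphic_of_isometry.
Qed.
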